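(* (Weighted sum formula) For any integers $k,n$ with $k>n\ge2$, $$\sum_{\mathbf{k}\in I^0_{k,n}}\widetilde{\mathcal{C}}(\widetilde{\mathbf{k}})\zeta^t(\mathbf{k})-t\sum_{\mathbf{k}\in I^0_{k,n-1}}\big(\widetilde{\mathcal{C}}(\mathbf{k})-\widetilde{\mathcal{C}}(\widetilde{\mathbf{k}})\big)\zeta^t(\mathbf{k})+(t-t^2)\sum_{\mathbf{k}\in I^0_{k,n-2}}b_{\mathbf{k}}\zeta^t(\mathbf{k})$$ $$=\left\{\sum_{i=1}^{n-2}\left[k\binom{k-1}{i}-(k-n+1)\binom{k-1}{i-1}\right]t^i(1-t)^{n-1-i}+k(1-t)^{n-1}+\binom{k-1}{n-1}t^{n-1}\right\}\zeta(k).$$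
   Context: An index is a finite sequence of positive integers; $I_{k,n}$ is the set of indices $(k_1,\ldots,k_n)$ of length $n$ with $k_1+\cdots+k_n=k$, and $I^0_{k,n}$ its subset with $k_1\ge2$; $I^0_{k,0}$ (the case $n=2$ of $I^0_{k,n-2}$) is empty. For an index $\mathbf k=(k_1,\ldots,k_n)$, $\mathcal{C}(\mathbf{k})=\sum_{j=1}^n2^{k_1+\cdots+k_j-j}+2^{k_1+\cdots+k_n-n}$, with $\mathcal C$ of the empty index equal to $1$, and $\widetilde{\mathcal C}(\mathbf k)=\mathcal C(k_1,\ldots,k_n)-\mathcal C(k_2,\ldots,k_n)$. For an index $\mathbf{k}=(k_1,\ldots,k_l)$ with $l\ge2$, $\widetilde{\mathbf k}=(k_1,\ldots,k_{l-1})$; for a length-one index $\mathbf k=(k)$ one sets $\widetilde{\mathcal C}(\widetilde{\mathbf k})=k$. For $n>2$ and $\mathbf k\in I^0_{k,n-2}$, $b_{\mathbf k}=\binom{k_1-2}{2}+\binom{k_2-1}{2}+\cdots+\binom{k_{n-2}-1}{2}$. For $k_1\ge2$, $\zeta(k_1,\ldots,k_n)=\sum_{m_1>\cdots>m_n>0}\prod m_j^{-k_j}$ and $\zeta^t(k_1,\ldots,k_n)=\sum_{\mathbf p}t^{n-\mathrm{dep}(\mathbf p)}\zeta(\mathbf p)$, summed over all sequences $\mathbf p$ obtained from $(k_1,\ldots,k_n)$ by replacing each separating comma by a comma or a plus sign ($\mathrm{dep}$ = length). *)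

(* Defs.v *)
From HB Require Import structures.
From mathcomp Require Import all_boot all_order all_algebra.
From mathcomp Require Import all_classical all_reals topology normedtype sequences.
Set Implicit Arguments. Unset Strict Implicit. Unset Printing Implicit Defensive.
Import Order.TTheory GRing.Theory Num.Theory.
Import numFieldNormedType.Exports.
Local Open Scope ring_scope.

(* k belongs to I^0_{k,n} (given as a seq nat whose length is fixed separately):
   all entries positive, sum equal to k, first entry >= 2. *)
Definition isI0 (k : nat) (s : seq nat) : bool :=
  [&& all (fun x => 0 < x)%N s, sumn s == k & (2 <= head 0%N s)%N].

(* sum of F over I^0_{k,n}: indices are enumerated as n-tuples with entries in
   {0,...,k} (every entry of an index of weight k is at most k). *)
Definition sum_I0 (R : nmodType) (k n : nat) (F : seq nat -> R) : R :=
  \sum_(s : n.-tuple 'I_k.+1 | isI0 k (map val s)) F (map val s).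

Definition Cc (s : seq nat) : nat :=
  (\sum_(1 <= j < (size s).+1) 2 ^ (sumn (take j s) - j)
   + 2 ^ (sumn s - size s))%N.

Definition Ct (R : pzRingType) (s : seq nat) : R := (Cc s)%:R - (Cc (behead s))%:R.

(* Ctilde(ktilde): ktilde drops the last entry for length >= 2;
   for a length-one index (k) it is set to k. *)
Definition Ctt (R : pzRingType) (s : seq nat) : R :=
  if (2 <= size s)%N then Ct R (belast (head 0%N s) (behead s))
  else (head 0%N s)%:R.

Definition bk (s : seq nat) : nat :=
  ('C(head 0%N s - 2, 2) + \sum_(x <- behead s) 'C(x - 1, 2))%N.

(* truncated MZV: sum over N >= m1 > m2 > ... > mn > 0 of prod m_j^{-k_j} *)
Fixpoint zetaN (R : realType) (s : seq nat) (N : nat) : R :=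
  match s with
  | [::] => 1
  | k :: s' => \sum_(1 <= m < N.+1) (m%:R ^- k * zetaN R s' m.-1)
  end.

Definition mzv (R : realType) (s : seq nat) : R := limn (zetaN R s).

(* compress bs s: replace the i-th separating comma of s by a plus sign
   iff the i-th boolean of bs is true *)
Fixpoint compress (bs : seq bool) (s : seq nat) : seq nat :=
  match bs, s with
  | b :: bs', k1 :: k2 :: s' =>
      if b then compress bs' ((k1 + k2)%N :: s') else k1 :: compress bs' (k2 :: s')
  | _, _ => s
  end.

Definition zetat (R : realType) (t : R) (s : seq nat) : R :=
  \sum_(bs : ((size s).-1).-tuple bool)
     t ^+ (size s - size (compress bs s)) * mzv R (compress bs s).

(* Main.v *)
(* For real t and y, consider formal power series in x (marking the weight), with
   y marking the length.  Writing G(m) for the series of all index sums whose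
   largest summation variable is m, the recursion on the first entry gives
   (m - v) G(m) = z (G(0) + ... + G(m-1)), with z = y x and v = (1 + t y) x.  The
   weights C~ make the corresponding series a convolution of G with 1/(m - x)
   (a shuffle product), and partial fractions turn the sum over m of the
   admissible part into the sum over m of (x/m) (G'(m) - t y G(m)), where G' is
   the derivative of G along dv = (1 - t) z, dz = z: the b_k-term is exactly what
   completes G'.  The derivative is carried by dual numbers.  The sum of G(m)/m
   is given by the sum formula, sum_m G(m)/m = z sum_j 1/((j - z)(j - v)), which
   follows by telescoping an inverse factorial expansion of 1/m; all identities
   hold for the truncated sums up to errors tending to 0 coefficientwise.  The
   theorem results from comparing the coefficients of y^n. *)
Require Import Defs.
From HB Require Import structures.
From mathcomp Require Import all_boot all_order all_algebra.
From mathcomp Require Import all_classical all_reals topology normedtype sequences.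
From mathcomp Require Import ring lra zify.
Import Order.TTheory GRing.Theory Num.Theory.
Import numFieldNormedType.Exports.
Set Implicit Arguments. Unset Strict Implicit. Unset Printing Implicit Defensive.
Local Open Scope ring_scope.

(** The first two sums merge: with [y] marking the length, an index of length n gets the weight y^n
    ((1 + t y) C~(k~) - t y C~(k)), the shift from n - 1 to n being a factor y. Raising the first
    entry by one doubles C, which moves the pole from v to x + v; since m - x - v = (a - x) + (b -
    v) whenever a + b = m, a convolution of 1/(a - x) with G is the natural candidate. The obstacle
    is convergence: the convolution and the part with first entry 1 need not have convergent sums
    separately, so every identity is proved for sums up to N with an explicit remainder. The
    coefficients of the remainders are bounded by powers of log N divided by N, and [ugr] stands in
    for these powers. The length variable [y] is a real number throughout, so that only the weight
    is formal; the length is recovered at the end from a polynomial identity valid for all real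
    [y]. *)

(** * Dual numbers and formal power series as commutative rings *)

Definition dual (B : Type) : Type := (B * B)%type.
HB.instance Definition _ (B : zmodType) := GRing.Zmodule.on (dual B).

Section DualRing.
Variable B : comNzRingType.
Implicit Types a b c : dual B.
Definition dual_mul a b : dual B := (a.1 * b.1, a.1 * b.2 + a.2 * b.1).
Definition dual_one : dual B := (1, 0).
Fact dual_mulA : associative dual_mul.
Proof. by move=> a b c; congr pair; rewrite /=; ring. Qed.
Fact dual_mulC : commutative dual_mul.
Proof. by move=> a b; congr pair; rewrite /=; ring. Qed.
Fact dual_mul1 : left_id dual_one dual_mul.
Proof. by move=> [a b]; congr pair; rewrite /=; ring. Qed.
Fact dual_mulD : left_distributive dual_mul +%R.
Proof. by move=> a b c; congr pair; rewrite /=; ring. Qed.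
Fact dual_one_neq0 : dual_one != 0.
Proof. by apply/eqP => -[] /eqP; rewrite oner_eq0. Qed.
HB.instance Definition _ := GRing.Zmodule_isComNzRing.Build (dual B)
  dual_mulA dual_mulC dual_mul1 dual_mulD dual_one_neq0.
End DualRing.

Definition fps (B : Type) : Type := nat -> B.
HB.instance Definition _ (B : zmodType) := GRing.Zmodule.on (fps B).

Section FpsRing.
Variable B : comNzRingType.
Implicit Types f g h : fps B.
Definition fps_mul f g : fps B := fun k => \sum_(i < k.+1) f i * g (k - i)%N.
Definition fps_one : fps B := fun k => (k == 0%N)%:R.
Let trunc n f : {poly B} := \poly_(i < n) f i.
(** Coefficient k of a product involves only coefficients up to k, so the ring laws can be inherited
    from polynomial truncations. *)
Lemma fps_mul_trunc n f g k : (k < n)%N -> fps_mul f g k = (trunc n f * trunc n g)`_k.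
Proof.
move=> kn; rewrite coefM; apply: eq_bigr => i _.
by rewrite !coef_poly !ifT //; have := ltn_ord i; lia.
Qed.
Fact fps_mulA : associative fps_mul.
Proof.
move=> f g h; apply/funext => k.
transitivity ((trunc k.+1 f * trunc k.+1 g * trunc k.+1 h)`_k).
  rewrite -mulrA coefM; apply: eq_bigr => i _.
  rewrite (@fps_mul_trunc k.+1) ?coef_poly ?ltn_ord //; have := ltn_ord i; lia.
rewrite coefM; apply: eq_bigr => i _.
rewrite (@fps_mul_trunc k.+1 f g) ?ltn_ord //.
by rewrite [X in _ * X]coef_poly ifT //; lia.
Qed.
Fact fps_mulC : commutative fps_mul.
Proof. by move=> f g; apply/funext => k; rewrite !(@fps_mul_trunc k.+1) // mulrC. Qed.
Fact fps_mul1 : left_id fps_one fps_mul.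
Proof.
move=> f; apply/funext => k; rewrite /fps_mul big_ord_recl /= mul1r subn0.
by rewrite big1 ?addr0 // => i _; rewrite mul0r.
Qed.
Fact fps_mulD : left_distributive fps_mul +%R.
Proof.
move=> f g h; apply/funext => k.
change (fps_mul (f + g) h k = fps_mul f h k + fps_mul g h k).
by rewrite /fps_mul -big_split; apply: eq_bigr => i _; exact: mulrDl.
Qed.
Fact fps_one_neq0 : fps_one != 0.
Proof. by apply/eqP => /(congr1 (@^~ 0%N)) /eqP; rewrite oner_eq0. Qed.
HB.instance Definition _ := GRing.Zmodule_isComNzRing.Build (fps B)
  fps_mulA fps_mulC fps_mul1 fps_mulD fps_one_neq0.
End FpsRing.

(** * Recurrences in the largest summation variable *)

Section Recurrences.
Variable A : comNzRingType.
Implicit Types (f g : nat -> A) (m N : nat).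

Definition psum f : nat -> A := fun m => \sum_(l < m) f l.
(** The product of power series is reused with the summation variable m as exponent and with
    coefficients in [A], which is itself later a ring of power series in the weight. *)
Definition conv f g : nat -> A := @fps_mul A f g.

Lemma psum0 f : psum f 0 = 0.
Proof. exact: big_ord0. Qed.

Lemma psumS f m : psum f m.+1 = psum f m + f m.
Proof. exact: big_ord_recr. Qed.

Lemma eq_psum f g m : (forall l, (l < m)%N -> f l = g l) -> psum f m = psum g m.
Proof. by move=> fg; apply: eq_bigr => i _; exact: fg. Qed.

(** Partial summation is convolution with the indicator of the positive integers, so this is
    associativity. *)
Lemma psum_conv f g m : psum (conv f g) m = conv f (psum g) m.
Proof.
have E h : psum h = conv h (fun k => (0 < k)%N%:R).
  apply/funext => k; rewrite /conv /fps_mul big_ord_recr /= subnn mulr0 addr0.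
  by apply: eq_bigr => i _; rewrite subn_gt0 ltn_ord mulr1.
by rewrite !E /conv fps_mulA.
Qed.

Lemma recurrence_unique (v z : A) (q a : nat -> A) f g :
    (forall m, (0 < m)%N -> (m%:R - v) * q m = 1) -> f 0%N = g 0%N ->
    (forall m, (0 < m)%N -> (m%:R - v) * f m = z * psum f m + a m) ->
    (forall m, (0 < m)%N -> (m%:R - v) * g m = z * psum g m + a m) ->
  f =1 g.
Proof.
move=> qE fg0 fE gE m; have [n] := ubnP m; elim: n m => // n IHn [//|m] ltmn.
have := fE m.+1 isT; rewrite (@eq_psum f g) -?gE // => [/(congr1 ( *%R (q m.+1)))|l ?].
  by rewrite !mulrA [q _ * _]mulrC qE // !mul1r.
by apply: IHn; lia.
Qed.
End Recurrences.

(** * The sum formula for truncated sums, with remainder *)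

Section SumFormula.
Variables (A : comNzRingType) (v z : A) (G q r iv : nat -> A).
Hypothesis qE : forall m, (0 < m)%N -> (m%:R - v) * q m = 1.
Hypothesis rE : forall m, (0 < m)%N -> (m%:R - z) * r m = 1.
Hypothesis ivE : forall m, (0 < m)%N -> m%:R * iv m = 1.
Hypothesis G0 : G 0%N = 1.
Hypothesis GE : forall m, (0 < m)%N -> (m%:R - v) * G m = z * psum G m.

(* [Wprod J m] is the remainder of the expansion of 1/m in the inverse factorial
   series sum_j prod_(i < j) (i - v) / prod_(i <= j) (m + i - v). *)
Definition Wprod (J m : nat) : A := \prod_(1 <= i < J.+1) ((i%:R - v) * q (m + i)).

Lemma Wprod0 m : Wprod 0 m = 1. Proof. by rewrite /Wprod big_geq. Qed.
Lemma WprodS J m : Wprod J.+1 m = Wprod J m * ((J.+1%:R - v) * q (m + J.+1)).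
Proof. by rewrite /Wprod big_nat_recr. Qed.
Lemma Wprodx0 J : Wprod J 0 = 1.
Proof. by elim: J => [|J IH]; rewrite ?Wprod0 // WprodS IH qE ?mulr1. Qed.

(** The denominators of the two products run over adjacent windows of length J and differ only in
    their end factors. *)
Lemma Wprod_shift J m :
  (m.+1%:R - v) * Wprod J m = ((m.+1 + J)%:R - v) * Wprod J m.+1.
Proof.
elim: J => [|J IH]; first by rewrite !Wprod0 addn0.
have E1 := @qE (m.+1 + J) isT; have E2 := @qE (m.+1 + J.+1) isT.
rewrite !WprodS mulrA IH -[(m + J.+1)%N]addSnnS.
transitivity (Wprod J m.+1 * (J.+1%:R - v) * (((m.+1 + J)%:R - v) * q (m.+1 + J))).
  by ring.
rewrite E1 mulr1.
have -> : ((m.+1 + J.+1)%:R - v) * (Wprod J m.+1 * ((J.+1%:R - v) * q (m.+1 + J.+1))) = Wprod J m.+1 * (J.+1%:R - v) * (((m.+1 + J.+1)%:R - v) * q (m.+1 + J.+1)) by ring.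
by rewrite E2 mulr1.
Qed.

(** By [GE] and [Wprod_shift], (J - z) G(m) W(J, m) equals z times the decrease of W(J, m) psum G (m
    + 1) from m - 1 to m, so the sum telescopes. *)
Lemma sum_G_Wprod J N :
  (J%:R - z) * \sum_(1 <= m < N.+1) G m * Wprod J m =
  z * (1 - Wprod J N * psum G N.+1).
Proof.
elim: N => [|N IH].
  by rewrite big_geq // psumS psum0 G0 Wprodx0; ring.
rewrite big_nat_recr //= mulrDr IH [psum G N.+2]psumS.
have E1 := GE (ltn0Sn N); have := Wprod_shift J N; rewrite natrD => E2.
have {}E1 : z * psum G N.+1 - (N.+1%:R - v) * G N.+1 = 0 by rewrite E1 subrr.
apply/eqP; rewrite -subr_eq0; apply/eqP.
transitivity (- (Wprod J N - Wprod J N.+1) *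
              (z * psum G N.+1 - (N.+1%:R - v) * G N.+1)
  + G N.+1 * ((N.+1%:R + J%:R - v) * Wprod J N.+1 - (N.+1%:R - v) * Wprod J N)).
  by ring.
by rewrite E1 E2; ring.
Qed.

(** Partial fractions give W(J, m)/m = W(J + 1, m)/m + W(J + 1, m)/(J + 1 - v); the last term is
    summed over m by [sum_G_Wprod]. *)
Lemma sum_formula_finite N J :
  \sum_(1 <= m < N.+1) iv m * G m =
    z * \sum_(1 <= j < J.+1) r j * q j
    - z * (\sum_(1 <= j < J.+1) r j * q j * Wprod j N) * psum G N.+1
    + \sum_(1 <= m < N.+1) iv m * G m * Wprod J m.
Proof.
elim: J => [|J IH].
  rewrite !(big_geq (leqnn 1)) mulr0 mul0r subr0 add0r.
  by apply: eq_bigr => m _; rewrite Wprod0 mulr1.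
have -> : \sum_(1 <= m < N.+1) iv m * G m * Wprod J.+1 m =
    \sum_(1 <= m < N.+1) iv m * G m * Wprod J m
    - q J.+1 * \sum_(1 <= m < N.+1) G m * Wprod J.+1 m.
  rewrite mulr_sumr -sumrB; apply: eq_big_nat => m /andP[m0 _].
  have E1 := qE (ltn0Sn J); have E2 := @qE (m + J.+1); have E3 := ivE m0.
  rewrite addnS in E2; have {}E2 := E2 isT.
  rewrite WprodS addnS; apply/eqP; rewrite -subr_eq0; apply/eqP.
  transitivity (iv m * G m * Wprod J m * (((m + J).+1%:R - v) * q (m + J).+1 - 1)
    + G m * Wprod J m * q (m + J).+1 * ((J.+1%:R - v) * q J.+1 - 1)
    - G m * Wprod J m * q (m + J).+1 * (m%:R * iv m - 1)); first by ring.
  by rewrite E1 E2 E3; ring.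
rewrite IH !(big_nat_recr J.+1) //=.
have E1 : \sum_(1 <= m < N.+1) G m * Wprod J.+1 m =
   r J.+1 * (z * (1 - Wprod J.+1 N * psum G N.+1)).
  by rewrite -sum_G_Wprod mulrA [r _ * _]mulrC rE // mul1r.
by rewrite E1; ring.
Qed.
End SumFormula.

(** * The shuffle convolution and the truncated weighted sum *)

Section WeightedSum.
Variables (A : comNzRingType) (x t y eps : A) (G h kappa p iv : nat -> A).
Let z := y * x.
Let v := x + t * z.
Let w := x + v.
Variable q : nat -> A.
Hypothesis pE : forall m, (0 < m)%N -> (m%:R - x) * p m = 1.
Hypothesis p0 : p 0%N = 0.
Hypothesis ivE : forall m, (0 < m)%N -> m%:R * iv m = 1.
Hypothesis qE : forall m, (0 < m)%N -> (m%:R - w) * q m = 1.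
Hypothesis G0 : G 0%N = 1.
Hypothesis GE : forall m, (0 < m)%N -> (m%:R - v) * G m = z * psum G m.
Hypothesis h0 : h 0%N = 0.
Hypothesis hE : forall m, (0 < m)%N -> (m%:R - w) * h m =
  z * psum h m + z * psum G m + t * z * (G m - y) - z * v * p m.
Hypothesis kappa0 : kappa 0%N = 0.
Hypothesis kappaE : forall m, (0 < m)%N -> (m%:R - v) * kappa m =
  z * psum kappa m + t * (1 - t) * z ^+ 2 * G m * p m.

Let Pc := conv p G.

(** On the term p(a) G(b) with a + b = m, write m - w = (a - x) + (b - v): the first summand cancels
    p(a), the second applies the recursion of G. That recursion fails at b = 0, where G = 1; this
    end produces the term - v p(m). *)
Lemma Pc_rec m : (0 < m)%N ->
  (m%:R - w) * Pc m = psum G m + z * psum Pc m - v * p m.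
Proof.
move=> m0; rewrite psum_conv.
have -> : psum G m = \sum_(i < m) G (m - i.+1)%N.
  by rewrite /psum (reindex_inj rev_ord_inj).
rewrite /Pc /conv /fps_mul !big_ord_recl /= p0 !mul0r !add0r.
case: m m0 => // m _; rewrite !big_ord_recr /=.
rewrite /bump /= !add1n !subnn psum0 G0 mulr0 addr0 !mulr1.
rewrite mulrDr.
have E1 := @pE m.+1 isT.
have -> : (m.+1%:R - w) * p m.+1 = (m.+1%:R - x) * p m.+1 - v * p m.+1.
  by rewrite /w; ring.
rewrite E1.
set S := (X in X + (1 - _)); set S1 := (X in X + 1 + _); set S2 := (X in _ + z * X - _).
suff -> : S = S1 + z * S2 by ring.
rewrite {}/S {}/S1 {}/S2 !mulr_sumr -big_split /=; apply: eq_bigr => i _.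
rewrite add1n; have lti := ltn_ord i.
have E2 := @pE i.+1 isT; have E3 := @GE (m.+1 - i.+1)%N.
have {}E3 := E3 ltac:(by lia).
have {}E3 : (m.+1 - i.+1)%:R * G (m.+1 - i.+1)%N =
   z * psum G (m.+1 - i.+1) + v * G (m.+1 - i.+1)%N.
  by rewrite -E3; ring.
have -> : (m.+1%:R - w) = (i.+1%:R - x) + ((m.+1 - i.+1)%:R - v).
  by rewrite /w -[in LHS](@subnKC i.+1 m.+1) ?natrD; [ring|lia].
move: E2 E3.
set g := G _; set H := psum G _; set k := (m.+1 - i.+1)%:R; set P := p _ => E2 E3.
apply/eqP; rewrite -subr_eq0; apply/eqP.
transitivity (((i.+1%:R - x) * P - 1) * g + P * (k * g - (z * H + v * g))).
  by ring.
by rewrite E2 E3; ring.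
Qed.

(** Both sides satisfy the same recurrence, whose solution is unique because m - w is invertible. *)
Lemma shuffle m : (0 < m)%N -> h m = z * Pc m - t * y * G m.
Proof.
move=> m0.
pose a m := z * psum G m + t * z * (G m - y) - z * v * p m.
(* The formula takes the value - t y at m = 0 while h(0) = 0; resetting this value adds t y to every
   partial sum. *)
pose g m := if m == 0%N then 0 else z * Pc m - t * y * G m.
have gE l : g l = z * Pc l - t * y * G l + t * y * (l == 0%N)%:R.
  case: l => [|l]; rewrite /g /= ?mulr0 ?addr0 // G0 /Pc /conv /fps_mul.
  by rewrite big_ord1 p0; ring.
have psg l : (0 < l)%N -> psum g l = z * psum Pc l - t * y * psum G l + t * y.
  case: l => // l _; elim: l => [|l IH].
    by rewrite !psumS !psum0 gE /=; ring.
  by rewrite psumS IH [psum G _.+2]psumS [psum Pc _.+2]psumS gE /=; ring.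
suff E : h =1 g by rewrite E /g gtn_eqF.
apply: (@recurrence_unique A w z q a) => // l l0.
  by rewrite hE // /a; ring.
rewrite psg // gE /a.
case: l l0 => // l _ /=.
have E1 := @Pc_rec l.+1 isT; have E2 := @GE l.+1 isT.
apply/eqP; rewrite -subr_eq0; apply/eqP.
transitivity (z * ((l.+1%:R - w) * Pc l.+1
                   - (psum G l.+1 + z * psum Pc l.+1 - v * p l.+1))
  - t * y * ((l.+1%:R - v) * G l.+1 - z * psum G l.+1)).
  by rewrite /w /z; ring.
by rewrite E1 E2; ring.
Qed.

(** By [GE], m G = x G + z (psum G + t G), where the term x G comes from raising the first entry.
    Hence [d] is the part of [G] with first entry at least 2, together with the empty index at m =
    0, and [c] is the part with first entry 1. *)
Let d m := if m == 0%N then 1 else x * iv m * G m.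
Let c m := G m - d m.
(* The last term removes the indices with first entry 1. *)
Let f m := h m - z * p m * (psum h m + t * h m)
           - iv m * (z * (psum G m + t * G m) - t * y * z).

(** Partial fractions turn the subtracted product headed by p(m) into a convolution of [p] with [c],
    up to explicit terms. It cancels against z [Pc] and leaves the convolution with [d], whose decay
    is good enough for passing to the limit. *)
Lemma adm_part_conv m : (0 < m)%N ->
  f m = z * conv p d m + z * p m * psum c m - c m + t * y * z * iv m
        - t * y * z * p m - t * z ^+ 2 * p m ^+ 2.
Proof.
move=> m0.
have E1 := pE m0; have E2 := ivE m0; have E3 := GE m0.
have psh : psum h m = z * psum Pc m - t * y * psum G m + t * y.
  case: m m0 {E1 E2 E3} => // m _; elim: m => [|m IH].
    rewrite !psumS !psum0 h0 G0 /Pc /conv /fps_mul big_ord1 p0; ring.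
  by rewrite psumS IH [psum G _.+2]psumS [psum Pc _.+2]psumS shuffle //; ring.
(* partial fractions: b p(a) p(a + b) = p(a) - p(a + b) *)
have key : z * p m * (z * psum Pc m + t * z * Pc m) =
    z * conv p c m - z * p m * psum c m + t * z ^+ 2 * p m ^+ 2.
  rewrite psum_conv.
  have -> : psum c m = \sum_(i < m) c (m - i.+1)%N.
    by rewrite /psum (reindex_inj rev_ord_inj).
  rewrite /Pc /conv /fps_mul !big_ord_recl /= p0 !mul0r !add0r.
  case: m m0 {E1 E2 E3 psh} => // m _; rewrite !big_ord_recr /=.
  rewrite /bump /= !add1n !subnn psum0 G0 mulr0 addr0.
  have -> : c 0 = 0 by rewrite /c /d /= G0 subrr.
  rewrite mulr0 !addr0 !mulr1.
  rewrite !mulr_sumr !mulrDr [X in _ + (X + _)]mulrA !mulr_sumr addrA -big_split /=.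
  rewrite -sumrB; congr (_ + _); last by ring.
  apply: eq_bigr => i _; rewrite add1n; have lti := ltn_ord i.
  have E1 := @pE m.+1 isT; have E2 := @pE i.+1 isT.
  have b0 : (0 < m.+1 - i.+1)%N by lia.
  have E3 := GE b0; have E4 := ivE b0.
  rewrite /c /d gtn_eqF //.
  have Em : (m.+1%:R : A) = i.+1%:R + (m.+1 - i.+1)%:R.
    by rewrite -natrD subnKC //; lia.
  rewrite {}Em in E1.
  move: E1 E2 E3 E4.
  set g := G _; set H := psum G _; set k := (m.+1 - i.+1)%:R; set P := p i.+1.
  set Q := p m.+1; set I := iv _; set a := i.+1%:R => E1 E2 E3 E4.
  apply/eqP; rewrite -subr_eq0; apply/eqP.
  transitivity (- z * P * Q * ((k - v) * g - z * H)
    + z * g * (1 - x * I) * (P * ((a + k - x) * Q - 1) - Q * ((a - x) * P - 1))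
    + z * g * x * P * Q * (k * I - 1)).
    by rewrite /v; ring.
  by rewrite E1 E2 E3 E4; ring.
have cd : conv p c m = Pc m - conv p d m.
  by rewrite /Pc /conv /fps_mul -sumrB; apply: eq_bigr => i _; rewrite /c; ring.
rewrite cd in key.
have cE : c m = G m - x * iv m * G m by rewrite /c /d gtn_eqF.
rewrite /f psh shuffle // cE.
move: (conv p d m) (psum c m) (Pc m) (psum Pc m) key => D C P HP key.
apply/eqP; rewrite -subr_eq0; apply/eqP.
transitivity (- (z * p m * (z * HP + t * z * P) -
    (z * (P - D) - z * p m * C + t * z ^+ 2 * p m ^+ 2))
  + (- t * y * p m + iv m) * ((m%:R - v) * G m - z * psum G m)
  + t * y * G m * ((m%:R - x) * p m - 1)
  - G m * (m%:R * iv m - 1)).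
  by rewrite /v; ring.
by rewrite key E1 E2 E3; ring.
Qed.

(** A closed form of G', justified by [Gd_rec]. Its value at 0 is 0 because G(0) is the constant
    1. *)
Let Gd m := if m == 0%N then 0 else
  kappa m + z * G m * psum p m + G m + (1 - t) * z * G m * p m.

(** Since v = x + t z, moving t z G to the right of [GE] leaves (m - x) G = z (psum G + t G): the
    first entry is summed as a geometric series. *)
Lemma G_pole m : (0 < m)%N -> z * p m * (psum G m + t * G m) = G m.
Proof.
move=> m0; have E1 := pE m0; have E3 := GE m0.
apply/eqP; rewrite -subr_eq0; apply/eqP.
transitivity (- p m * ((m%:R - v) * G m - z * psum G m)
  + G m * ((m%:R - x) * p m - 1)); first by rewrite /v; ring.
by rewrite E1 E3; ring.
Qed.

(** Summation by parts: the products p(m) psum d and d(m) psum p, with the diagonal p(m) d(m),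
    assemble to the product of two partial sums. What remains is the product minus the truncated
    convolution, that is, the pairs with a + b > N. *)
Lemma weighted_sum_finite N :
  \sum_(1 <= m < N.+1) (f m + x * iv m * kappa m) =
  \sum_(1 <= m < N.+1) (x * iv m * (Gd m - t * y * G m) + t * y * z * (iv m - p m)
                        - t * z ^+ 2 * p m ^+ 2)
  - z * (psum p N.+1 * psum d N.+1 - psum (conv p d) N.+1).
Proof.
elim: N => [|N IH].
  rewrite !big_geq // !psumS !psum0 p0 /conv /fps_mul big_ord1 p0; ring.
rewrite !(big_nat_recr N.+1) //= IH [psum p N.+2]psumS [psum d N.+2]psumS.
rewrite [psum (conv _ _) N.+2]psumS adm_part_conv //.
have E1 := @pE N.+1 isT; have E2 := @ivE N.+1 isT; have E3 := @G_pole N.+1 isT.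
have psc : psum c N.+1 = psum G N.+1 - psum d N.+1.
  by rewrite /psum -sumrB.
rewrite psc /c {3 4 5}/d /Gd /=.
have dE : d N.+1 = x * iv N.+1 * G N.+1 by [].
rewrite !dE.
move: (psum (conv _ _) _) (conv _ _ _) (psum p _) (psum d _) => D C P S.
apply/eqP; rewrite -subr_eq0; apply/eqP.
transitivity ((z * p N.+1 * (psum G N.+1 + t * G N.+1) - G N.+1)
  + t * z * G N.+1 * p N.+1 * (N.+1%:R * iv N.+1 - 1)
  - t * z * G N.+1 * iv N.+1 * ((N.+1%:R - x) * p N.+1 - 1)).
  by rewrite /z; ring.
by rewrite E1 E2 E3; ring.
Qed.

Let v2 := v + eps * (1 - t) * z.
Let z2 := z + eps * z.
Hypothesis eps2 : eps * eps = 0.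
Lemma Gd_rec m : (0 < m)%N ->
  (m%:R - v) * Gd m = (1 - t) * z * G m + z * psum Gd m + z * psum G m.
Proof.
(* The left side vanishes at k = 1, and its increment in [k] is the defect of [G_pole], which is
   zero. *)
have aux k : (0 < k)%N -> z * psum p k * psum G k - z * psum (fun l => G l * psum p l) k
     + 1 - psum G k - (1 - t) * z * psum (fun l => G l * p l) k = 0.
  case: k => // k _; elim: k => [|k IH].
    by rewrite !psumS !psum0 G0 p0; ring.
  rewrite psumS [psum G k.+2]psumS ![psum _ k.+2]psumS.
  rewrite -[RHS]IH; have E := @G_pole k.+1 isT.
  apply/eqP; rewrite -subr_eq0; apply/eqP.
  transitivity (z * p k.+1 * (psum G k.+1 + t * G k.+1) - G k.+1); first by ring.
  by rewrite E subrr.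
have psGd k : (0 < k)%N -> psum Gd k = psum kappa k +
    z * psum (fun l => G l * psum p l) k + psum G k - 1 +
    (1 - t) * z * psum (fun l => G l * p l) k.
  case: k => // k _; elim: k => [|k IH].
    by rewrite !psumS !psum0 G0 p0 kappa0 /Gd /=; ring.
  rewrite psumS IH [psum kappa k.+2]psumS [psum G k.+2]psumS ![psum _ k.+2]psumS.
  by rewrite {1}/Gd /=; ring.
move=> m0; have E1 := GE m0; have E2 := G_pole m0; have E3 := aux m m0.
have E4 := kappaE m0.
rewrite psGd // /Gd gtn_eqF //.
move: E3; set S1 := psum (fun l => G l * psum p l) m.
set S2 := psum (fun l => G l * p l) m => E3.
apply/eqP; rewrite -subr_eq0; apply/eqP.
transitivity (((m%:R - v) * kappa m - (z * psum kappa m + t * (1 - t) * z ^+ 2 * G m * p m))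
  + (z * psum p m + 1 + (1 - t) * z * p m) * ((m%:R - v) * G m - z * psum G m)
  + (1 - t) * z * (z * p m * (psum G m + t * G m) - G m)
  + z * (z * psum p m * psum G m - z * S1 + 1 - psum G m - (1 - t) * z * S2)).
  by ring.
by rewrite E1 E2 E3 E4; ring.
Qed.

(** To first order in [eps] this is the recursion of G together with its derivative. Hence the sum
    formula over dual numbers contains the differentiated sum formula. *)
Lemma perturbed_rec m : (0 < m)%N ->
  (m%:R - v2) * (G m + eps * Gd m) = z2 * psum (fun l => G l + eps * Gd l) m.
Proof.
move=> m0; have E1 := GE m0; have E2 := Gd_rec m0.
have -> : psum (fun l => G l + eps * Gd l) m = psum G m + eps * psum Gd m.
  by rewrite /psum mulr_sumr -big_split.
apply/eqP; rewrite -subr_eq0; apply/eqP.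
transitivity (((m%:R - v) * G m - z * psum G m)
  + eps * ((m%:R - v) * Gd m - ((1 - t) * z * G m + z * psum Gd m + z * psum G m))
  - eps * eps * ((1 - t) * z * Gd m + z * psum Gd m)).
  by rewrite /v2 /z2; ring.
by rewrite E1 E2 eps2; ring.
Qed.
End WeightedSum.

(** * Power series in the weight over dual numbers *)

Section Fps.
Variable R : realType.
Local Notation D := (dual R).
Local Notation A := (fps (dual R)).

Definition dre (a : R) : D := (a, 0).
Definition cst (a : D) : A := fun k => if k == 0%N then a else 0.
Definition fpsX : A := fun k => (k == 1%N)%:R.
Definition fpsR (a : R) : A := cst (dre a).
Definition deps : D := (0, 1).
Definition fps_eps : A := cst deps.
(** The geometric series of 1/(m - a X). At m = 0 the total inverse makes it 0, which is the value
    of p(0) that the convolutions need. *)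
Definition pinv (a : D) (m : nat) : A := fun k => a ^+ k * dre (m%:R ^- k.+1).

Lemma dreD a b : dre (a + b) = dre a + dre b.
Proof. by congr pair => /=; rewrite ?addr0. Qed.
Lemma dreM a b : dre (a * b) = dre a * dre b.
Proof. by congr pair => /=; ring. Qed.
Lemma dreN a : dre (- a) = - dre a.
Proof. by congr pair => /=; rewrite oppr0. Qed.
Lemma dre0 : dre 0 = 0. Proof. by []. Qed.
Lemma dre1 : dre 1 = 1. Proof. by []. Qed.
Lemma dre_nat n : dre n%:R = n%:R.
Proof. by elim: n => // n IH; rewrite -natr1 dreD IH dre1 natr1. Qed.
Lemma dreX a n : dre (a ^+ n) = dre a ^+ n.
Proof. by elim: n => // n IH; rewrite !exprS dreM IH. Qed.
Lemma dre_sum I (r : seq I) (F : I -> R) : dre (\sum_(i <- r) F i) = \sum_(i <- r) dre (F i).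
Proof. exact: (big_morph dre dreD dre0). Qed.

Lemma fps_coef_mul (f g : A) k : (f * g) k = \sum_(i < k.+1) f i * g (k - i)%N.
Proof. by []. Qed.
Lemma fps_coefD (f g : A) k : (f + g) k = f k + g k. Proof. by []. Qed.
Lemma fps_coefN (f : A) k : (- f) k = - f k. Proof. by []. Qed.
Lemma fps_coef0 k : (0 : A) k = 0. Proof. by []. Qed.
Lemma fps_coef_sum I (r : seq I) P (F : I -> A) k :
  (\sum_(i <- r | P i) F i) k = \sum_(i <- r | P i) F i k.
Proof. exact: (big_morph (fun f : A => f k) (fun f g => fps_coefD f g k) (fps_coef0 k)). Qed.

Lemma fps_coef_cstM a (f : A) k : (cst a * f) k = a * f k.
Proof.
rewrite fps_coef_mul big_ord_recl /= subn0 big1 ?addr0 // => i _.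
by rewrite /cst /= mul0r.
Qed.
Lemma fps_coef_XM0 (f : A) : (fpsX * f) 0%N = 0.
Proof. by rewrite fps_coef_mul big_ord1 /fpsX /= mul0r. Qed.
Lemma fps_coef_XMS (f : A) k : (fpsX * f) k.+1 = f k.
Proof.
rewrite fps_coef_mul !big_ord_recl /= mul0r add0r mul1r subSS subn0 big1 ?addr0 // => i _.
by rewrite /fpsX /= mul0r.
Qed.

Lemma cstM a b : cst (a * b) = cst a * cst b.
Proof. by apply/funext => k; rewrite fps_coef_cstM /cst; case: eqP; rewrite ?mulr0. Qed.
Lemma cstD a b : cst (a + b) = cst a + cst b.
Proof. by apply/funext => k; rewrite fps_coefD /cst; case: eqP; rewrite ?addr0. Qed.
Lemma cstN a : cst (- a) = - cst a.
Proof. by apply/funext => k; rewrite fps_coefN /cst; case: eqP; rewrite ?oppr0. Qed.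
Lemma cst1 : cst 1 = 1.
Proof. by apply/funext => k; rewrite /cst; case: eqP => [->|]//; case: k. Qed.
Lemma cst0 : cst 0 = 0.
Proof. by apply/funext => k; rewrite /cst; case: eqP. Qed.
Lemma cst_nat n : cst n%:R = n%:R.
Proof. by elim: n => [|n IH]; [exact: cst0|rewrite -natr1 cstD IH cst1 natr1]. Qed.

Lemma fpsRD a b : fpsR (a + b) = fpsR a + fpsR b. Proof. by rewrite /fpsR dreD cstD. Qed.
Lemma fpsRM a b : fpsR (a * b) = fpsR a * fpsR b. Proof. by rewrite /fpsR dreM cstM. Qed.
Lemma fpsRN a : fpsR (- a) = - fpsR a. Proof. by rewrite /fpsR dreN cstN. Qed.
Lemma fpsR_nat n : fpsR n%:R = n%:R. Proof. by rewrite /fpsR dre_nat cst_nat. Qed.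
Lemma fpsR0 : fpsR 0 = 0. Proof. exact: cst0. Qed.
Lemma fpsR1 : fpsR 1 = 1. Proof. exact: (fpsR_nat 1). Qed.
Lemma fpsRX a n : fpsR (a ^+ n) = fpsR a ^+ n.
Proof. by elim: n => [|n IH]; rewrite ?fpsR1 // !exprS fpsRM IH. Qed.

Lemma fps_eps2 : fps_eps * fps_eps = 0.
Proof. by rewrite -cstM -cst0; congr cst; congr pair => /=; ring. Qed.

Lemma fpsR_inv m : (0 < m)%N -> m%:R * fpsR m%:R^-1 = 1.
Proof. by move=> m0; rewrite -fpsR_nat -fpsRM divff ?fpsR1 // pnatr_eq0 -lt0n. Qed.

Lemma pinvE a m : (0 < m)%N -> (m%:R - cst a * fpsX) * pinv a m = 1.
Proof.
move=> m0; have mn0 : (m%:R : R) != 0 by rewrite pnatr_eq0 -lt0n.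
have mV k : (m%:R : D) * dre (m%:R ^- k.+1) = dre (m%:R ^- k).
  by rewrite -dre_nat -dreM exprS invfM mulrA divff ?mul1r.
rewrite mulrBl -mulrA -cst_nat; apply/funext => -[|k].
  rewrite fps_coefD fps_coefN !fps_coef_cstM fps_coef_XM0 mulr0 subr0 /pinv expr0 mul1r mV.
  by rewrite expr0 invr1.
rewrite fps_coefD fps_coefN !fps_coef_cstM fps_coef_XMS /pinv mulrCA mV exprS -mulrA.
exact: subrr.
Qed.
End Fps.

(** * Indices by weight and their generating series *)

Definition incr (q : seq nat) : seq nat := if q is k :: s then k.+1 :: s else [::].
Local Notation pos := (all (fun k : nat => (0 < k)%N)).

(** The two branches are the two ways of raising the weight by one that drive [Gc_rec]. The empty
    index is left out of the second, as [incr] fixes it. *)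
Fixpoint comps (k : nat) : seq (seq nat) :=
  if k is k'.+1 then
    [seq 1%N :: q | q <- comps k'] ++ [seq incr q | q <- comps k' & q != [::]]
  else [:: [::]].

Lemma mem_comps k q : (q \in comps k) = pos q && (sumn q == k).
Proof.
elim: k q => [|k IH] q /=.
  by case: q => [|[|a] s] //=; rewrite inE /= !addSn andbF.
rewrite mem_cat; apply/orP/andP => [[/mapP[q' ]|/mapP[q']]|[]].
- by rewrite IH => /andP[pq /eqP <-] ->.
- rewrite mem_filter IH => /and3P[]; case: q' => [//|a s] _ ps /eqP <- ->.
  by split; [move: ps => /andP[] | rewrite /= addSn].
- case: q => [|[|[|a]] s] //= ps /eqP E.
    by left; apply/mapP; exists s => //; rewrite IH; apply/andP; split=> //; apply/eqP; lia.
  right; apply/mapP; exists (a.+1 :: s) => //.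
  by rewrite mem_filter IH; apply/and3P; split=> //; apply/eqP; rewrite /=; lia.
Qed.

Lemma incr_inj : {in [pred q | q != [::]] &, injective incr}.
Proof. by move=> [|a s] [|b s'] // _ _ [-> ->]. Qed.

Lemma uniq_comps k : uniq (comps k).
Proof.
elim: k => [//|k IH] /=; rewrite cat_uniq map_inj_uniq ?IH => [|a b [] //].
rewrite map_inj_in_uniq ?filter_uniq // ?andbT => [|a b].
  apply/hasPn => q /mapP[q']; rewrite mem_filter mem_comps => /and3P[q'n pq' _] ->.
  by apply/mapP => -[s _]; case: q' q'n pq' => [|[]].
by rewrite !mem_filter => /andP[an _] /andP[bn _]; exact: incr_inj.
Qed.

Lemma sum_comps (M : nmodType) (F : seq nat -> M) k :
  \sum_(q <- comps k.+1) F q =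
  \sum_(q <- comps k) F (1%N :: q) + \sum_(q <- comps k | q != [::]) F (incr q).
Proof. by rewrite /= big_cat !big_map big_filter. Qed.

Section Compositions.
Variables (R : realType) (t : R).
Local Notation A := (fps (dual R)).
Local Notation X := (@fpsX R).

(* [st s m] is the part of zeta^t(s) with largest summation variable [m]: the
   two terms are the comma and the plus sign after the first entry. *)
Fixpoint st (s : seq nat) (m : nat) : R :=
  if s is k :: s' then m%:R ^- k * (\sum_(l < m) st s' l + t * st s' m)
  else (m == 0%N)%:R.

(* Coefficient [k] collects the indices of weight [k] with largest summation
   variable [m]; prefixing an entry 1 and incrementing the first entry generate
   all indices, hence [Gc_rec]. *)
Definition Gc (c : seq nat -> R) (m : nat) : A :=
  fun k => dre (\sum_(q <- comps k) c q * st q m).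

Lemma Gc_ext c c' m : (0 < m)%N ->
  (forall q, pos q -> q != [::] -> c q = c' q) -> Gc c m = Gc c' m.
Proof.
move=> m0 cc'; apply/funext => k; rewrite /Gc; congr dre.
rewrite !big_seq; apply: eq_bigr => q; rewrite mem_comps => /andP[pq _].
by case: (eqVneq q [::]) => [->|qn]; rewrite /= ?gtn_eqF ?mulr0 // cc'.
Qed.

Lemma Gc_ext_nil c c' m : (forall q, pos q -> c q = c' q) -> Gc c m = Gc c' m.
Proof.
move=> cc'; apply/funext => k; rewrite /Gc; congr dre.
by rewrite !big_seq; apply: eq_bigr => q; rewrite mem_comps => /andP[pq _]; rewrite cc'.
Qed.

Lemma GcD c c' m : Gc (fun q => c q + c' q) m = Gc c m + Gc c' m.
Proof.
apply/funext => k; rewrite fps_coefD /Gc -dreD -big_split /=.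
by congr dre; apply: eq_bigr => q _; rewrite mulrDl.
Qed.

Lemma GcZ a c m : Gc (fun q => a * c q) m = fpsR a * Gc c m.
Proof.
apply/funext => k; rewrite fps_coef_cstM /Gc -dreM mulr_sumr.
by congr dre; apply: eq_bigr => q _; rewrite mulrA.
Qed.

Lemma psumD f g m : psum (fun l => f l + g l : A) m = psum f m + psum g m.
Proof. by rewrite /psum big_split. Qed.

Lemma psumZ (a : A) f m : psum (fun l => a * f l) m = a * psum f m.
Proof. by rewrite /psum mulr_sumr. Qed.

Lemma st0 q : pos q -> q != [::] -> st q 0 = 0.
Proof. by case: q => [|[|a] s] //= _ _; rewrite exprS mul0r invr0 mul0r. Qed.

Lemma Gc0 c : Gc c 0 = fpsR (c [::]).
Proof.
apply/funext => k; rewrite /Gc /fpsR /cst.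
case: k => [|k]; first by rewrite /= big_seq1 /= mulr1.
rewrite /= -dre0; congr dre; rewrite -/(comps k.+1) big_seq big1 // => q.
rewrite mem_comps => /andP[pq /eqP sq]; rewrite st0 ?mulr0 //.
by case: q sq {pq}.
Qed.

Lemma Gc_nil m : Gc (fun q => (q == [::])%:R) m = (m == 0%N)%:R.
Proof.
case: m => [|m]; first by rewrite Gc0 eqxx fpsR1.
rewrite (@Gc_ext _ (fun q => 0 * (size q)%:R)) // => [|q _ /negPf ->].
  by rewrite GcZ fpsR0 mul0r.
by rewrite mul0r.
Qed.

Lemma psum_delta m : (0 < m)%N -> psum (fun l => (l == 0%N)%:R : A) m = 1.
Proof.
case: m => // m _; elim: m => [|m IH]; first by rewrite psumS psum0 add0r.
by rewrite psumS IH addr0.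
Qed.

Lemma Gc_rec c m : (0 < m)%N -> m%:R * Gc c m =
  X * (psum (Gc (c \o cons 1%N)) m + fpsR t * Gc (c \o cons 1%N) m + Gc (c \o incr) m).
Proof.
move=> m0; have mn0 : (m%:R : R) != 0 by rewrite pnatr_eq0 -lt0n.
rewrite -fpsR_nat; apply/funext => -[|k].
  by rewrite fps_coef_XM0 fps_coef_cstM /Gc /= big_seq1 /= gtn_eqF // mulr0 mulr0.
rewrite fps_coef_XMS !fps_coefD !fps_coef_cstM /psum fps_coef_sum /Gc -dre_sum -!dreM -!dreD; congr dre.
rewrite sum_comps mulrDr exchange_big /= !mulr_sumr -big_split /=; congr (_ + _).
  apply: eq_bigr => q _; rewrite -mulr_sumr expr1.
  by rewrite mulrCA mulrA [X in X * _]mulrC -mulrA; field.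
rewrite [RHS](bigID (fun q => q == [::])) /= [X in _ = X + _]big1 ?add0r => [|q /eqP ->].
  apply: eq_bigr => -[|a s] // _ /=.
  by rewrite exprS; field; rewrite expf_neq0.
by rewrite /= gtn_eqF // mulr0.
Qed.

Lemma Gc_size1 m : (0 < m)%N ->
  Gc (fun q => (size q == 1%N)%:R) m = X * pinv 1 m.
Proof.
move=> m0; have E := Gc_rec (fun q => (size q == 1%N)%:R) m0.
rewrite (@Gc_ext (_ \o incr) (fun q => (size q == 1%N)%:R)) // in E => [|[]//].
have E1 : Gc ((fun q => (size q == 1%N)%:R) \o cons 1%N) = fun m => (m == 0%N)%:R.
  by apply/funext => l; rewrite -Gc_nil; apply: Gc_ext_nil => -[].
rewrite E1 psum_delta // gtn_eqF //= in E.
have E2 := @pinvE R 1 m m0; rewrite cst1 in E2.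
set g := Gc _ m in E *; set p := pinv _ _ in E2 *.
apply/eqP; rewrite -subr_eq0; apply/eqP.
transitivity (p * (m%:R * g - X * (1 + fpsR t * 0 + g)) - (g) * ((m%:R - 1 * X) * p - 1)).
  by ring.
by rewrite E E2; ring.
Qed.
End Compositions.

(** * Generating series for the weights C~ and b *)

(** Positive entries make the natural subtractions in the exponents exact. Consequently a prefixed 1
    adds one to C, and raising the first entry by one doubles C. *)
Lemma Cc_cons k s : (0 < k)%N -> pos s -> Cc (k :: s) = (2 ^ k.-1 * (1 + Cc s))%N.
Proof.
move=> k0 ps.
have le_take j : (j <= size s)%N -> (j <= sumn (take j s))%N.
  elim: s j ps {k0} => [|a s IH] [|j] //= /andP[a0 ps] lej.
  by have := IH _ ps lej; lia.
rewrite /Cc big_ltn //= take0 addn0 big_add1 /= subn1 mulnDr muln1 -addnA.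
congr addn; rewrite mulnDr big_distrr /=; congr addn.
  apply: eq_big_nat => j /andP[_ lej]; rewrite -expnD; congr expn.
  by have := le_take j lej; lia.
rewrite -expnD; congr expn; have := le_take _ (leqnn _); rewrite take_size; lia.
Qed.

Lemma Cc_nil : Cc [::] = 1%N.
Proof. by rewrite /Cc big_geq. Qed.

Lemma pos_belast a s : pos (a :: s) -> pos (belast a s).
Proof. by rewrite lastI all_rcons => /andP[]. Qed.

Section Coefficients.
Variables (R : realType) (t y : R).
Local Notation A := (fps (dual R)).
Local Notation X := (fpsX R).
Local Notation t' := (fpsR t).
Local Notation y' := (fpsR y).
Local Notation Gc := (Gc t).

Definition chop (q : seq nat) : seq nat := belast (head 0%N q) (behead q).
(** The merged weight of the first two sums, with C in place of C~; subtracting [Uc], which is [Vc]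
    of the tail, turns C into C~. *)
Definition Vc (q : seq nat) : R := if q is [::] then 0 else
  y ^+ size q * ((1 + t * y) * (Cc (chop q))%:R - t * y * (Cc q)%:R).
Definition Uc (q : seq nat) : R := y * Vc (behead q).
Definition yc (q : seq nat) : R := y ^+ size q.
(** The increment of [Bc] when the first entry is raised, because binom(a, 2) - binom(a - 1, 2) = a
    - 1. *)
Definition Ec (q : seq nat) : R := y ^+ size q * (head 0%N q - 1)%:R.
Definition Bc (q : seq nat) : R := y ^+ size q * (\sum_(a <- q) 'C(a - 1, 2))%:R.
Definition adm (c : seq nat -> R) (q : seq nat) : R := if (1 < head 0 q)%N then c q else 0.

Lemma Vc_1cons q : pos q ->
  Vc (1%N :: q) = y * Vc q + (y * yc q + (- (t * y ^+ 2)) * (q == [::])%:R).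
Proof.
case: q => [|a s] /= ps.
  by rewrite /yc /chop /= Cc_nil Cc_cons // Cc_nil /=; ring.
have pb : pos (belast a s) by rewrite pos_belast.
rewrite /yc /chop /= (@Cc_cons 1 (belast a s)) // (@Cc_cons 1 (a :: s)) //.
move: (Cc (belast a s)) (Cc (a :: s)) => b c.
by rewrite expn0 !mul1n !exprS; move: (y ^+ size s) => Y; ring.
Qed.

(** Both values of C double, except that for length one the chopped index is empty and its C stays
    1; this is the correction term. *)
Lemma Vc_incr q : pos q -> q != [::] ->
  Vc (incr q) = 2%:R * Vc q + (- (y * (1 + t * y))) * (size q == 1%N)%:R.
Proof.
case: q => [//|[//|a] [|b s]] ps _.
  by rewrite /Vc /chop /= Cc_nil !Cc_cons // Cc_nil /= expnS; ring.
have pbs : pos (b :: s) by case/andP: ps.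
rewrite /Vc /chop /= (@Cc_cons a.+2 (belast b s)) ?pos_belast //.
rewrite (@Cc_cons a.+1 (belast b s)) ?pos_belast //.
rewrite (@Cc_cons a.+2 (b :: s)) // (@Cc_cons a.+1 (b :: s)) //=.
move: (Cc (belast b s)) (Cc (b :: s)) => c d.
by rewrite expnS !exprS; move: (y ^+ size s) => Y; ring.
Qed.

Let G := Gc yc.
Let h := Gc Vc.
Let kappa m := fpsR (t * (1 - t) * y ^+ 2) * Gc Bc m.
Let z := y' * X.
Let v := X + t' * z.
Let p := pinv (1 : dual R).

Lemma pinv1E m : (0 < m)%N -> (m%:R - X) * p m = 1.
Proof. by move=> m0; have := @pinvE R 1 m m0; rewrite cst1 mul1r. Qed.

Lemma Gc_yc0 : G 0%N = 1.
Proof. by rewrite /G Gc0 /yc expr0 fpsR1. Qed.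

Lemma Gc_yc_rec m : (0 < m)%N -> (m%:R - v) * G m = z * psum G m.
Proof.
move=> m0; have := Gc_rec t yc m0.
have -> : Gc (yc \o cons 1%N) = fun m => y' * G m.
  by apply/funext => l; rewrite -GcZ; apply: Gc_ext_nil => q _; rewrite /yc /= exprS.
rewrite (@Gc_ext _ _ (yc \o incr) yc) // => [|[]//]; rewrite psumZ -/G => E.
by rewrite mulrBl E /v /z; ring.
Qed.

Lemma Gc_Vc0 : h 0%N = 0.
Proof. by rewrite /h Gc0 fpsR0. Qed.

Lemma Gc_Vc_rec m : (0 < m)%N -> (m%:R - (X + v)) * h m =
  z * psum h m + z * psum G m + t' * z * (G m - y') - z * v * p m.
Proof.
move=> m0; have := Gc_rec t Vc m0.
have -> : Gc (Vc \o cons 1%N) = fun m => y' * h m + (y' * G m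
    + fpsR (- (t * y ^+ 2)) * (m == 0%N)%:R).
  apply/funext => l; rewrite -(Gc_nil t) -!GcZ -!GcD.
  by apply: Gc_ext_nil => q pq; rewrite -Vc_1cons.
have -> : Gc (Vc \o incr) m = 2%:R * h m - y' * (1 + t' * y') * (X * p m).
  rewrite -(Gc_size1 t) // -(@fpsR_nat _ 2).
  have -> : y' * (1 + t' * y') = fpsR (y * (1 + t * y)).
    by rewrite fpsRM fpsRD fpsR1 fpsRM.
  rewrite -mulNr -fpsRN -!GcZ -GcD.
  by apply: Gc_ext => // q pq qn; rewrite /= Vc_incr.
rewrite !psumD !psumZ psum_delta // -/h gtn_eqF //= fpsRN fpsRM fpsRX /v /z => E.
by rewrite mulrBl E; ring.
Qed.

Lemma kappa_at0 : kappa 0%N = 0.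
Proof. by rewrite /kappa Gc0 /Bc big_nil mulr0 fpsR0 mulr0. Qed.

Lemma Gc_Ec m : (0 < m)%N -> Gc Ec m = X * p m * G m.
Proof.
move=> m0; have := Gc_rec t Ec m0; have E1 := pinv1E m0.
have -> : Gc (Ec \o cons 1%N) = fun=> 0.
  apply/funext => l; rewrite (@Gc_ext_nil _ _ _ (fun q => 0 * yc q)) => [|q _].
    by rewrite GcZ fpsR0 mul0r.
  by rewrite /Ec /= subnn mulr0 mul0r.
rewrite (@Gc_ext _ _ (Ec \o incr) (fun q => Ec q + yc q)) // => [|[//|[//|a] s] _ _]; last first.
  by rewrite /Ec /yc /= !subn1 /= -natr1; ring.
rewrite GcD -/G /psum big1 // => E.
apply/eqP; rewrite -subr_eq0; apply/eqP; set g := Gc Ec m in E *.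
transitivity (- g * ((m%:R - X) * p m - 1) + p m * (m%:R * g -
   X * (0 + t' * 0 + (g + G m)))); first by ring.
by rewrite E E1; ring.
Qed.

Lemma kappa_rec m : (0 < m)%N -> (m%:R - v) * kappa m =
  z * psum kappa m + t' * (1 - t') * z ^+ 2 * G m * p m.
Proof.
move=> m0; have := Gc_rec t Bc m0.
have -> : Gc (Bc \o cons 1%N) = fun m => y' * Gc Bc m.
  apply/funext => l; rewrite -GcZ; apply: Gc_ext_nil => q _.
  by rewrite /Bc /= big_cons exprS mulrA.
rewrite (@Gc_ext _ _ (Bc \o incr) (fun q => Bc q + Ec q)) // => [|[//|[//|a] s] _ _]; last first.
  by rewrite /Bc /Ec /= !big_cons !subn1 /= binS bin1 !natrD; ring.
rewrite GcD Gc_Ec // !psumZ => E.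
rewrite /kappa !fpsRM fpsRD fpsRN fpsR1.
apply/eqP; rewrite -subr_eq0; apply/eqP; set g := Gc Bc m in E *.
transitivity (t' * (1 - t') * y' ^+ 2 * (m%:R * g - X *
   (y' * psum (Gc Bc) m + t' * (y' * g) + (g + X * p m * G m)))).
  by rewrite /v /z; ring.
by rewrite E; ring.
Qed.

Lemma Gc_Uc m : (0 < m)%N -> Gc Uc m = z * p m * (psum h m + t' * h m).
Proof.
move=> m0; have := Gc_rec t Uc m0; have E1 := pinv1E m0.
have -> : Gc (Uc \o cons 1%N) = fun m => y' * h m.
  by apply/funext => l; rewrite -GcZ.
rewrite (@Gc_ext _ _ (Uc \o incr) Uc) // => [|[]//]; rewrite psumZ => E.
apply/eqP; rewrite -subr_eq0; apply/eqP; set g := Gc Uc m in E *.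
transitivity (- g * ((m%:R - X) * p m - 1) + p m * (m%:R * g -
   X * (y' * psum h m + t' * (y' * h m) + g))); first by rewrite /z; ring.
by rewrite E E1; ring.
Qed.

Lemma Gc_adm_weight m : (0 < m)%N ->
  Gc (adm (fun q => Vc q - Uc q)) m =
  h m - z * p m * (psum h m + t' * h m)
  - fpsR m%:R^-1 * (z * (psum G m + t' * G m) - t' * y' * z).
Proof.
(* [Wn] carries the indices with first entry 1. There [Vc_1cons] cancels C altogether, so their
   series is explicit in G and can be subtracted. *)
move=> m0; pose Wn q := if (1 < head 0 q)%N then 0 else Vc q - Uc q.
rewrite -Gc_Uc //.
have E0 : Gc Wn m = fpsR m%:R^-1 * (z * (psum G m + t' * G m) - t' * y' * z).
  have := Gc_rec t Wn m0.
  have -> : Gc (Wn \o cons 1%N) = fun m => y' * G m + fpsR (- (t * y ^+ 2)) * (m == 0%N)%:R.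
    apply/funext => l; rewrite -(Gc_nil t) -!GcZ -!GcD.
    apply: Gc_ext_nil => q pq.
    have -> : (Wn \o cons 1%N) q = Vc (1%N :: q) - y * Vc q by [].
    by rewrite Vc_1cons //; ring.
  rewrite (@Gc_ext _ _ (Wn \o incr) (fun q => 0 * yc q)) // => [|[//|[//|a] s] _ _]; last first.
    by rewrite /Wn /= mul0r.
  rewrite GcZ fpsR0 mul0r psumD !psumZ psum_delta // gtn_eqF //.
  rewrite fpsRN fpsRM fpsRX => E; have E1 := @fpsR_inv R m m0.
  apply/eqP; rewrite -subr_eq0; apply/eqP; set g := Gc Wn m in E *.
  rewrite /= in E.
  transitivity (- g * (m%:R * fpsR m%:R^-1 - 1) + fpsR m%:R^-1 * (m%:R * g - 
    X * (y' * psum G m + - (t' * y' ^+ 2) * 1 + t' * (y' * G m + - (t' * y' ^+ 2) * 0) + 0))).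
    by rewrite /z; ring.
  by rewrite E E1; ring.
rewrite -E0.
have -> : h m = Gc (adm (fun q => Vc q - Uc q)) m + (Gc Uc m + Gc Wn m).
  rewrite -!GcD; apply: Gc_ext => // q _ _.
  by rewrite /adm /Wn; case: ifP => _; ring.
by ring.
Qed.

(** Admissible indices are the incremented nonempty ones, and incrementing turns the shift by 2 in
    the first binomial of [bk] into the shift by 1 used in [Bc]. *)
Lemma Gc_adm_bk m : (0 < m)%N ->
  Gc (adm (fun q => t * (1 - t) * y ^+ 2 * (y ^+ size q * (bk q)%:R))) m =
  X * fpsR m%:R^-1 * kappa m.
Proof.
move=> m0; set c := adm _; have := Gc_rec t c m0.
have -> : Gc (c \o cons 1%N) = fun=> 0.
  apply/funext => l; rewrite (@Gc_ext_nil _ _ _ (fun q => 0 * yc q)) => [|q _].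
    by rewrite GcZ fpsR0 mul0r.
  by rewrite /c /adm /= mul0r.
rewrite (@Gc_ext _ _ (c \o incr) (fun q => t * (1 - t) * y ^+ 2 * Bc q)) // => [|[//|[//|a] s] _ _]; last first.
  by rewrite /c /adm /= /Bc /bk /= big_cons !subn1 subn2.
rewrite GcZ /psum big1 // => E; have E1 := @fpsR_inv R m m0.
apply/eqP; rewrite -subr_eq0; apply/eqP; set g := Gc c m in E *.
transitivity (- g * (m%:R * fpsR m%:R^-1 - 1) + fpsR m%:R^-1 * (m%:R * g - 
    X * (0 + t' * 0 + kappa m))).
  by ring.
by rewrite E E1 /kappa; ring.
Qed.
End Coefficients.

(** * Coefficientwise growth estimates *)

Section Bounds.
Variable R : realType.
Local Notation D := (dual R).
Local Notation A := (fps (dual R)).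
Local Notation X := (fpsX R).

Definition dnorm (a : D) : R := `|a.1| + `|a.2|.

Lemma dnorm_ge0 a : 0 <= dnorm a.
Proof. by rewrite addr_ge0. Qed.

Lemma dnormD a b : dnorm (a + b) <= dnorm a + dnorm b.
Proof.
by rewrite /dnorm /= addrACA; apply: lerD; exact: ler_normD.
Qed.

Lemma dnormM a b : dnorm (a * b) <= dnorm a * dnorm b.
Proof.
rewrite /dnorm /=.
have H := ler_normD (a.1 * b.2) (a.2 * b.1).
rewrite !normrM in H *.
have := mulr_ge0 (normr_ge0 a.2) (normr_ge0 b.2).
by move: H; lra.
Qed.

Lemma dnorm_dre a : dnorm (dre a) = `|a|.
Proof. by rewrite /dnorm /= normr0 addr0. Qed.

Lemma dnorm0 : dnorm 0 = 0.
Proof. by rewrite /dnorm normr0 addr0. Qed.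

Lemma dnorm_sum I (r : seq I) (F : I -> D) :
  dnorm (\sum_(i <- r) F i) <= \sum_(i <- r) dnorm (F i).
Proof.
elim: r => [|i r IH]; first by rewrite !big_nil dnorm0.
by rewrite !big_cons; apply: (le_trans (dnormD _ _)); rewrite lerD2l.
Qed.

(* Coefficients up to [k] of the family [f] are O(g), uniformly in the index. *)
Definition bd I k (f : I -> A) (g : I -> R) :=
  exists2 C, 0 <= C & forall i j, (j <= k)%N -> dnorm (f i j) <= C * g i.

Lemma bd_mono I k (f : I -> A) (g g' : I -> R) c : 0 <= c ->
  (forall i, g i <= c * g' i) -> bd k f g -> bd k f g'.
Proof.
move=> c0 gg' [C C0 fg]; exists (C * c); first exact: mulr_ge0.
by move=> i j jk; apply: (le_trans (fg i j jk)); rewrite -mulrA ler_wpM2l.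
Qed.

Lemma bd_mul I k (f f' : I -> A) g g' : bd k f g -> bd k f' g' ->
  bd k (fun i => f i * f' i) (fun i => g i * g' i).
Proof.
move=> [C C0 fg] [C' C'0 fg']; exists (k.+1%:R * (C * C')); first by rewrite !mulr_ge0.
move=> i j jk; rewrite fps_coef_mul; apply: (le_trans (dnorm_sum _ _)).
have H0 : 0 <= (C * C') * (g i * g' i).
  rewrite mulrACA; apply: mulr_ge0; apply: le_trans (dnorm_ge0 _) _;
  [exact: (fg i 0%N)|exact: (fg' i 0%N)].
apply: (@le_trans _ _ (\sum_(l < j.+1) (C * C') * (g i * g' i))).
  apply: ler_sum => l _; apply: (le_trans (dnormM _ _)); rewrite mulrACA.
  apply: ler_pM; rewrite ?dnorm_ge0 //; [apply: fg|apply: fg'];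
    have := ltn_ord l; lia.
by rewrite sumr_const card_ord -[leLHS]mulr_natl -[leRHS]mulrA ler_wpM2r // ler_nat.
Qed.

Lemma bd_cst I k (a : A) : bd k (fun _ : I => a) (fun=> 1).
Proof.
exists (\sum_(l < k.+1) dnorm (a l)); first by apply: sumr_ge0 => *; exact: dnorm_ge0.
move=> _ j jk; rewrite mulr1 (bigD1 (Ordinal (jk : (j < k.+1)%N))) //= lerDl.
by apply: sumr_ge0 => *; exact: dnorm_ge0.
Qed.

Lemma bd_cmul I k (a : A) (f : I -> A) g : bd k f g -> bd k (fun i => a * f i) g.
Proof.
move=> fg; have := bd_mul (@bd_cst I k a) fg.
by apply: (@bd_mono _ _ _ _ _ 1) => // i; rewrite !mul1r.
Qed.

Lemma bd_add I k (f f' : I -> A) g : bd k f g -> bd k f' g ->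
  bd k (fun i => f i + f' i) g.
Proof.
move=> [C C0 fg] [C' C'0 fg']; exists (C + C'); first exact: addr_ge0.
move=> i j jk; rewrite fps_coefD; apply: (le_trans (dnormD _ _)).
by rewrite mulrDl; apply: lerD; [exact: fg|exact: fg'].
Qed.

Lemma bd_X I k (f : I -> A) g : bd k f g -> bd k.+1 (fun i => X * f i) g.
Proof.
move=> [C C0 fg]; exists C => // i [_|j jk]; last by rewrite fps_coef_XMS; exact: fg.
rewrite fps_coef_XM0 dnorm0.
exact: le_trans (dnorm_ge0 _) (fg i 0%N (leq0n k)).
Qed.

Lemma bd_X0 I (f : I -> A) (g : I -> R) : bd 0 (fun i => X * f i) g.
Proof.
exists 0 => // i [|j] // _.
by rewrite fps_coef_XM0 dnorm0 mul0r.
Qed.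

Lemma bd_sum I k (f : I * nat -> A) (g : I * nat -> R) (r : I -> seq nat) : bd k f g ->
  bd k (fun i => \sum_(l <- r i) f (i, l)) (fun i => \sum_(l <- r i) g (i, l)).
Proof.
move=> [C C0 fg]; exists C => // i j jk; rewrite fps_coef_sum.
apply: (le_trans (dnorm_sum _ _)); rewrite mulr_sumr.
by apply: ler_sum => l _; exact: fg.
Qed.

Lemma bd_comp I J k (f : I -> A) g (h : J -> I) : bd k f g ->
  bd k (fun j => f (h j)) (fun j => g (h j)).
Proof. by move=> [C C0 fg]; exists C => // i; exact: fg. Qed.

Lemma bd_ext I k (f f' : I -> A) g : f =1 f' -> bd k f g -> bd k f' g.
Proof. by move=> E [C C0 fg]; exists C => // i j jk; rewrite -E; exact: fg. Qed.

(* Any product growing slower than [n ^+ (1/8)] but dominating the powers of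
   the logarithm would do; 27^-1 gives [ugr8] by three squarings. *)
Definition ugr (n : nat) : R := \prod_(i < n) (1 + 27^-1 / i.+1%:R).

Lemma ugrS n : ugr n.+1 = ugr n + 27^-1 * (ugr n / n.+1%:R).
Proof. by rewrite /ugr big_ord_recr /=; ring. Qed.

Lemma ugr_ge1 n : 1 <= ugr n.
Proof.
elim: n => [|n IH]; first by rewrite /ugr big_ord0.
rewrite ugrS; apply: (le_trans IH); rewrite lerDl.
apply: mulr_ge0; first by rewrite invr_ge0.
by apply: divr_ge0 => //; exact: le_trans IH.
Qed.

Lemma ugr_ge0 n : 0 <= ugr n. Proof. exact: le_trans (ugr_ge1 n). Qed.

Lemma ugr_mono : {homo ugr : m n / (m <= n)%N >-> m <= n}.
Proof.
apply: homo_leq => // [a b c|n]; first exact: le_trans.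
rewrite ugrS lerDl; apply: mulr_ge0; first by rewrite invr_ge0.
by apply: divr_ge0 => //; exact: ugr_ge0.
Qed.

Lemma ugr8 n : ugr n ^+ 8 <= n.+1%:R.
Proof.
elim: n => [|n IH]; first by rewrite /ugr big_ord0 expr1n.
have -> : ugr n.+1 ^+ 8 = ugr n ^+ 8 * (1 + 27^-1 / n.+1%:R) ^+ 8.
  by rewrite -exprMn ugrS; congr (_ ^+ 8); ring.
have step (a : R) : 0 <= a -> a <= 1 -> (1 + a) ^+ 2 <= 1 + 3 * a.
  move=> a0 a1; have : a * a <= a by rewrite ler_piMr.
  by rewrite expr2; lra.
have n0 : 0 < (n.+1%:R : R) by rewrite ltr0n.
set b := n.+1%:R^-1.
have b0 : 0 <= b by rewrite /b invr_ge0 ltW.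
have b1 : b <= 1 by rewrite /b invf_le1 // ler1n.
have H1 : (1 + 27^-1 * b) ^+ 8 <= 1 + b.
  rewrite -[8%N]/(2 * (2 * 2))%N 2!exprM.
  have E1 : (1 + 27^-1 * b) ^+ 2 <= 1 + 9^-1 * b.
    have := step (27^-1 * b); lra.
  have E2 : ((1 + 27^-1 * b) ^+ 2) ^+ 2 <= 1 + 3^-1 * b.
    apply: (@le_trans _ _ ((1 + 9^-1 * b) ^+ 2)).
      by apply: lerXn2r; rewrite ?nnegrE //; [rewrite sqr_ge0|lra].
    have := step (9^-1 * b); lra.
  apply: (@le_trans _ _ ((1 + 3^-1 * b) ^+ 2)).
    by apply: lerXn2r; rewrite ?nnegrE //; [rewrite sqr_ge0|lra].
  have := step (3^-1 * b); lra.
apply: (@le_trans _ _ (n.+1%:R * (1 + b))).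
  apply: ler_pM => //; rewrite ?exprn_ge0 ?ugr_ge0 //; last lra.
by rewrite mulrDr mulr1 /b divff ?gt_eqF // natr1.
Qed.

(** Summation against 1/l costs only a constant, whereas it would raise a power of the logarithm;
    this is what makes [ugr] convenient. *)
Lemma sum_ugr n : \sum_(l < n) ugr l / l.+1%:R <= 27 * ugr n.
Proof.
suff -> : \sum_(l < n) ugr l / l.+1%:R = 27 * (ugr n - 1).
  by rewrite mulrBr; lra.
elim: n => [|n IH]; first by rewrite big_ord0 /ugr big_ord0; ring.
by rewrite big_ord_recr /= IH ugrS; move: (ugr n / _) => a; field.
Qed.

Lemma sum_inv n : \sum_(l < n) l.+1%:R^-1 <= 27 * ugr n.
Proof.
apply: le_trans (sum_ugr n); apply: ler_sum => l _.
by rewrite -[leLHS]mul1r ler_wpM2r ?ugr_ge1 // invr_ge0.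
Qed.

(** The factor X makes the increment of a coefficient depend on lower coefficients only. By
    induction on [k] the increment is O(ugr N/(N + 1)), which sums to O(ugr N) again. *)
Lemma growth I k (Q a : I -> nat -> A) :
  (forall k, bd k (fun i => Q i 0%N) (fun=> 1)) ->
  (forall i N, Q i N.+1 = Q i N + X * (a i N * Q i N)) ->
  (forall k, bd k (fun x => a x.1 x.2) (fun x => x.2.+1%:R^-1)) ->
  bd k (fun x => Q x.1 x.2) (fun x => ugr x.2).
Proof.
move=> bQ0 QS ba.
suff step j : bd j (fun x => X * (a x.1 x.2 * Q x.1 x.2)) (fun x => ugr x.2 / x.2.+1%:R) ->
    bd j (fun x => Q x.1 x.2) (fun x => ugr x.2).
  elim: k => [|k IH]; apply: step; first exact: bd_X0.
  apply: bd_X; have := bd_mul (ba k) IH.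
  by apply: (@bd_mono _ _ _ _ _ 1) => // x; rewrite mul1r mulrC.
move=> [C C0 bC]; have [C' C'0 bC'] := bQ0 j.
exists (C' + C * 27) => [|[i N] l lj /=]; first by rewrite addr_ge0 ?mulr_ge0.
(* This sharper bound is inductive: 27 [ugr] grows by exactly ugr N/(N + 1) at each step and [ugr]
   starts at 1. *)
suff : dnorm (Q i N l) <= C' + C * 27 * (ugr N - 1).
  move/le_trans; apply; rewrite mulrDl mulrBr mulr1.
  have : C' <= C' * ugr N by rewrite ler_peMr ?ugr_ge1.
  have : 0 <= C * 27 by rewrite mulr_ge0.
  by lra.
elim: N => [|N IH]; first by have := bC' i l lj; rewrite /ugr big_ord0 subrr mulr0 mulr1 addr0.
rewrite QS fps_coefD; apply: (le_trans (dnormD _ _)).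
apply: (le_trans (lerD IH (bC (i, N) l lj))); rewrite /= ugrS.
rewrite le_eqVlt; apply/orP; left; apply/eqP; by field; rewrite nat1r pnatr_eq0.
Qed.

Lemma bd_pinv k (a : D) : bd k (pinv a) (fun m => m%:R^-1).
Proof.
exists (\sum_(l < k.+1) dnorm (a ^+ l)) => [|m j jk].
  by apply: sumr_ge0 => *; exact: dnorm_ge0.
apply: (le_trans (dnormM _ _)); rewrite dnorm_dre ger0_norm ?invr_ge0 ?exprn_ge0 //.
apply: ler_pM; rewrite ?dnorm_ge0 ?invr_ge0 ?exprn_ge0 //.
  rewrite (bigD1 (Ordinal (jk : (j < k.+1)%N))) //= lerDl.
  by apply: sumr_ge0 => *; exact: dnorm_ge0.
case: m => [|m]; first by rewrite exprS mul0r invr0.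
rewrite lef_pV2 ?posrE ?ltr0n ?exprn_gt0 ?ltr0n //.
by rewrite exprS ler_peMr // exprn_ege1 // ler1n.
Qed.

Lemma bd_fpsR I k (f : I -> R) : bd k (fun i => fpsR (f i)) (fun i => `|f i|).
Proof.
exists 1 => // i j _; rewrite mul1r /fpsR /cst; case: eqP => _.
  by rewrite dnorm_dre.
by rewrite dnorm0.
Qed.

Local Open Scope classical_set_scope.

(** Squaring reduces the claim to [ugr8]: the square is at most 1/(n + 1). *)
Lemma cvg_ugr4 : (ugr n ^+ 4 / n.+1%:R) @[n --> \oo] --> (0 : R).
Proof.
apply/cvgr0Pnorm_lt => e e0.
have /cvgr0Pnorm_lt/(_ (e ^+ 2) (exprn_gt0 2 e0)) := @cvg_harmonic R.
apply: filterS => n; rewrite /harmonic ger0_norm ?invr_ge0 // => He.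
have N0 : 0 < (n.+1%:R : R) by rewrite ltr0n.
have U0 : 0 <= ugr n ^+ 4 / n.+1%:R by rewrite divr_ge0 // exprn_ge0 // ugr_ge0.
rewrite ger0_norm //.
suff H : (ugr n ^+ 4 / n.+1%:R) ^+ 2 < e ^+ 2 by rewrite ltr_pXn2r ?nnegrE // ltW in H.
apply: le_lt_trans He.
rewrite expr_div_n -exprM ler_pdivrMr ?exprn_gt0 // expr2 mulrA mulVf ?gt_eqF // mul1r.
exact: ugr8.
Qed.

Lemma bd_cvg k (f : nat -> A) : bd k f (fun n => ugr n ^+ 4 / n.+1%:R) ->
  (f n k).2 @[n --> \oo] --> (0 : R).
Proof.
move=> [C C0 fC]; apply/cvgr0Pnorm_lt => e e0.
have [C1|C1] := eqVneq C 0.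
  near=> n; have := fC n k (leqnn k); rewrite C1 mul0r /dnorm => H.
  have := normr_ge0 (f n k).1; lra.
have Cp : 0 < C by rewrite lt_def C1.
have /cvgr0Pnorm_lt H := cvg_ugr4.
have := H (e / C) (divr_gt0 e0 Cp); apply: filterS => n.
rewrite ger0_norm ?divr_ge0 ?exprn_ge0 ?ugr_ge0 // => Hn.
have {}Hn : C * (ugr n ^+ 4 / n.+1%:R) < e by rewrite mulrC -ltr_pdivlMr.
apply: le_lt_trans Hn; apply: le_trans (fC n k (leqnn k)).
by rewrite /dnorm lerDr.
Unshelve. all: by end_near. Qed.
End Bounds.

(** * The remainders tend to 0 *)

Section SumAsymptotics.
Variables (R : realType) (al be : dual R) (G : nat -> fps (dual R)).
Local Notation A := (fps (dual R)).
Local Notation X := (fpsX R).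
Local Notation iv m := (fpsR (m%:R : R)^-1).
Local Notation v := (cst al * X).
Local Notation z := (cst be * X).
Local Notation q := (pinv al).
Local Notation r := (pinv be).
Hypothesis G0 : G 0%N = 1.
Hypothesis GE : forall m, (0 < m)%N -> (m%:R - v) * G m = z * psum G m.

Lemma G_psum m : (0 < m)%N -> G m = X * (cst be * q m * psum G m).
Proof.
move=> m0; have E := GE m0; have E1 := pinvE al m0.
apply/eqP; rewrite -subr_eq0; apply/eqP.
transitivity (q m * ((m%:R - v) * G m - z * psum G m) - G m * ((m%:R - v) * q m - 1)).
  by ring.
by rewrite E E1; ring.
Qed.

Lemma bd_psumG k : bd k (fun N => psum G N.+1) (@ugr R).
Proof.
pose Q (_ : unit) N := psum G N.+1.
suff /(bd_comp (fun N => (tt, N))) : bd k (fun x => Q x.1 x.2) (fun x => ugr R x.2) by [].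
apply: (@growth _ _ _ _ (fun _ N => cst be * q N.+1)) => [j|u N|j].
- by rewrite /Q psumS psum0 add0r G0; exact: bd_cst.
- by rewrite /Q psumS G_psum.
- by apply: bd_cmul; exact: (bd_comp (fun x : unit * nat => x.2.+1) (bd_pinv j al)).
Qed.

Lemma bd_G k : bd k (fun m => G m.+1) (fun m => ugr R m / m.+1%:R).
Proof.
apply: (@bd_ext _ _ _ (fun m => X * (cst be * (q m.+1 * psum G m.+1)))) => [m|].
  by rewrite (G_psum (ltn0Sn m)) -!mulrA.
do 2 apply: bd_cmul.
have := bd_mul (bd_comp S (bd_pinv k al)) (bd_psumG k).
by apply: (@bd_mono _ _ _ _ _ _ 1) => // m; rewrite mul1r mulrC.
Qed.

(** The value of [Wprod] at v = 0, namely 1/binom(m + J, J). It carries all the decay, both in J and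
    in m. *)
Let cW (J m : nat) : R := \prod_(1 <= i < J.+1) (i%:R / (m + i)%:R).
Let NJ (J : nat) : A := \prod_(1 <= i < J.+1) (1 - v * iv i).
Let MJ (m J : nat) : A := \prod_(1 <= i < J.+1) ((m + i)%:R * q (m + i)).

Lemma cW_ge0 J m : 0 <= cW J m.
Proof. by apply: prodr_ge0 => i _; rewrite divr_ge0. Qed.

Lemma cW_le_J J m : cW J m.+1 <= J.+1%:R^-1.
Proof.
elim: J => [|J IH]; first by rewrite /cW big_geq // invr1.
rewrite /cW big_nat_recr //= -/(cW J m.+1).
apply: (@le_trans _ _ (J.+1%:R^-1 * (J.+1%:R / J.+2%:R))).
  apply: ler_pM => //; rewrite ?cW_ge0 ?divr_ge0 // ler_wpM2l //.
  by rewrite lef_pV2 ?posrE ?ltr0n // ler_nat; lia.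
by rewrite mulrA mulVf ?pnatr_eq0 // mul1r.
Qed.

Lemma cW_le_m J m : cW J.+1 m <= m.+1%:R^-1.
Proof.
elim: J => [|J IH]; first by rewrite /cW big_nat1 mul1r addn1.
rewrite /cW big_nat_recr //= -/(cW J.+1 m) -[leRHS]mulr1.
apply: ler_pM => //; rewrite ?cW_ge0 ?divr_ge0 //.
by rewrite ler_pdivrMr ?ltr0n ?mul1r ?ler_nat; lia.
Qed.

(** Each factor (i - v)/(m + i - v) is split as (1 - v/i), (m + i)/(m + i - v) and i/(m + i); the
    first two products grow at most like [ugr]. *)
Lemma Wprod_factor J m : Wprod v q J m = NJ J * MJ m J * fpsR (cW J m).
Proof.
elim: J => [|J IH].
  by rewrite Wprod0 /NJ /MJ /cW !big_geq // fpsR1 !mulr1.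
rewrite WprodS IH /NJ /MJ /cW !(big_nat_recr J.+1) //= fpsRM.
rewrite -/(NJ J) -/(MJ m J) -/(cW J m) fpsRM fpsR_nat.
have E1 := @fpsR_inv R J.+1 isT.
have E2 := @fpsR_inv R (m + J.+1); rewrite addnS in E2 *; have {}E2 := E2 isT.
move: (fpsR (cW J m)) (NJ J) (MJ m J) (iv J.+1) (iv (m + J).+1) E1 E2 => c a b i1 i2 E1 E2.
apply/eqP; rewrite -subr_eq0; apply/eqP.
transitivity (a * b * c * q (m + J).+1 * (v * (J.+1%:R * i1 - 1)
   - (J.+1%:R - v * (J.+1%:R * i1)) * ((m + J).+1%:R * i2 - 1))); first by ring.
by rewrite E1 E2; ring.
Qed.

Lemma bd_NJ k : bd k NJ (@ugr R).
Proof.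
pose Q (_ : unit) N := NJ N.
suff /(bd_comp (fun N => (tt, N))) : bd k (fun x => Q x.1 x.2) (fun x => ugr R x.2) by [].
apply: (@growth _ _ _ _ (fun _ N => - cst al * iv N.+1)) => [j|u N|j].
- by rewrite /Q /NJ big_geq //; exact: bd_cst.
- by rewrite /Q /NJ big_nat_recr //=; ring.
- apply: bd_cmul; apply: (@bd_mono _ _ _ _ (fun x : unit * nat => `|x.2.+1%:R^-1|) _ 1) => //.
    by move=> x; rewrite mul1r ger0_norm // invr_ge0.
  exact: bd_fpsR.
Qed.

Lemma bd_MJ k : bd k (fun x => MJ x.1 x.2) (fun x => ugr R x.2).
Proof.
apply: (@growth _ _ _ _ (fun m N => cst al * q (m + N.+1))) => [j|m N|j].
- apply: (@bd_ext _ _ _ (fun=> 1)) => [m|]; first by rewrite /MJ big_geq.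
  exact: bd_cst.
- rewrite /MJ big_nat_recr //= -/(MJ m N); have E := @pinvE R al (m + N.+1).
  rewrite addnS in E *; have {}E := E isT.
  apply/eqP; rewrite -subr_eq0; apply/eqP.
  transitivity (MJ m N * (((m + N).+1%:R - v) * q (m + N).+1 - 1)); first by ring.
  by rewrite E; ring.
- apply: bd_cmul.
  have := bd_comp (fun x : nat * nat => (x.1 + x.2.+1)%N) (bd_pinv j al).
  apply: (@bd_mono _ _ _ _ _ _ 1) => // x; rewrite mul1r.
  by rewrite lef_pV2 ?posrE ?ltr0n ?ler_nat; lia.
Qed.

Lemma bd_W k : bd k (fun x : nat * nat => Wprod v q x.2 x.1)
  (fun x => ugr R x.2 ^+ 2 * cW x.2 x.1).
Proof.
apply: bd_ext (fun x => esym (Wprod_factor x.2 x.1)) _.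
have H1 := bd_comp (fun x : nat * nat => x.2) (bd_NJ k).
have H2 := bd_fpsR k (fun x : nat * nat => cW x.2 x.1).
have := bd_mul (bd_mul H1 (bd_MJ k)) H2.
apply: (@bd_mono _ _ _ _ _ _ 1) => // x.
by rewrite mul1r expr2 ger0_norm ?cW_ge0.
Qed.

Lemma bd_invR k : bd k (fun m : nat => iv m.+1) (fun m => m.+1%:R^-1).
Proof.
have := bd_fpsR k (fun m : nat => m.+1%:R^-1 : R).
apply: (@bd_mono _ _ _ _ _ _ 1) => // x.
by rewrite mul1r ger0_norm ?invr_ge0.
Qed.

(** The exponent 4 is needed for the first remainder of the sum formula: two factors from [Wprod],
    one from [psum G], one from a harmonic sum. *)
Let bnd N : R := ugr R N ^+ 4 / N.+1%:R.

(** The expansion is stopped at J = N. Then [E1] is small because [Wprod] is evaluated at m = N, and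
    [E2] because it has N factors. *)
Lemma sum_formula_asymptotic k :
  bd k (fun N => \sum_(1 <= m < N.+1) iv m * G m - z * \sum_(1 <= j < N.+1) r j * q j) bnd.
Proof.
pose E1 N := \sum_(0 <= j < N) (r j.+1 * q j.+1 * Wprod v q j.+1 N) * psum G N.+1.
pose E2 N := \sum_(0 <= m < N) iv m.+1 * G m.+1 * Wprod v q N m.+1.
apply: (@bd_ext _ _ _ (fun N => - z * E1 N + E2 N)) => [N|].
  rewrite (@sum_formula_finite A v z G q r (fun m => iv m) (@pinvE _ al)
    (@pinvE _ be) (@fpsR_inv R) G0 GE N N) /E1 /E2 -mulr_suml.
  rewrite ![in RHS]big_add1 /=; ring.
apply: bd_add; first apply: bd_cmul.
- have H1 : bd k (fun x : nat * nat => r x.2.+1 * q x.2.+1 * Wprod v q x.2.+1 x.1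
      * psum G x.1.+1)
    (fun x => x.2.+1%:R^-1 * x.2.+1%:R^-1 * (ugr R x.2.+1 ^+ 2 * cW x.2.+1 x.1) * ugr R x.1).
    have K1 := bd_comp (fun x : nat * nat => x.2.+1) (bd_pinv k be).
    have K2 := bd_comp (fun x : nat * nat => x.2.+1) (bd_pinv k al).
    have K3 := bd_comp (fun x : nat * nat => (x.1, x.2.+1)) (bd_W k).
    have K4 := bd_comp (fun x : nat * nat => x.1) (bd_psumG k).
    exact: bd_mul (bd_mul (bd_mul K1 K2) K3) K4.
  have := bd_sum (fun N => index_iota 0 N) H1.
  apply: (@bd_mono _ _ _ _ _ _ 27) => // N /=.
  apply: (@le_trans _ _ (\sum_(0 <= j < N) (ugr R N ^+ 3 / N.+1%:R) * j.+1%:R^-1)).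
    apply: ler_sum_nat => j /andP[_ jN].
    have j0 : 0 <= j.+1%:R^-1 :> R by rewrite invr_ge0.
    have j1 : j.+1%:R^-1 <= 1 :> R by rewrite invf_le1 ?ler1n ?ltr0n.
    have uj : ugr R j.+1 ^+ 2 <= ugr R N ^+ 2.
      by apply: lerXn2r; rewrite ?nnegrE ?ugr_ge0 //; exact: ugr_mono.
    have -> : ugr R N ^+ 3 / N.+1%:R * j.+1%:R^-1 =
      j.+1%:R^-1 * 1 * (ugr R N ^+ 2 * N.+1%:R^-1) * ugr R N by ring.
    apply: ler_wpM2r; first exact: ugr_ge0.
    apply: ler_pM; rewrite ?mulr_ge0 ?exprn_ge0 ?ugr_ge0 ?cW_ge0 //.
      by apply: ler_wpM2l.
    by apply: ler_pM; rewrite ?exprn_ge0 ?ugr_ge0 ?cW_ge0 // cW_le_m.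
  rewrite -mulr_sumr big_mkord /bnd.
  have -> : 27 * (ugr R N ^+ 4 / N.+1%:R) = ugr R N ^+ 3 / N.+1%:R * (27 * ugr R N) by ring.
  apply: ler_wpM2l; last exact: sum_inv.
  by rewrite divr_ge0 ?exprn_ge0 ?ugr_ge0.
- have H1 : bd k (fun x : nat * nat => iv x.2.+1 * G x.2.+1 * Wprod v q x.1 x.2.+1)
    (fun x => x.2.+1%:R^-1 * (ugr R x.2 / x.2.+1%:R) * (ugr R x.1 ^+ 2 * cW x.1 x.2.+1)).
    have K1 := bd_comp (fun x : nat * nat => x.2) (bd_invR k).
    have K2 := bd_comp (fun x : nat * nat => x.2) (bd_G k).
    have K3 := bd_comp (fun x : nat * nat => (x.2.+1, x.1)) (bd_W k).
    exact: bd_mul (bd_mul K1 K2) K3.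
  have := bd_sum (fun N => index_iota 0 N) H1.
  apply: (@bd_mono _ _ _ _ _ _ 27) => // N /=.
  apply: (@le_trans _ _ (\sum_(0 <= j < N) (ugr R N ^+ 2 / N.+1%:R) * (ugr R j / j.+1%:R))).
    apply: ler_sum_nat => j /andP[_ jN].
    have j0 : 0 <= j.+1%:R^-1 :> R by rewrite invr_ge0.
    have j1 : j.+1%:R^-1 <= 1 :> R by rewrite invf_le1 ?ler1n ?ltr0n.
    have U0 : 0 <= ugr R j / j.+1%:R by rewrite mulr_ge0 ?ugr_ge0.
    have -> : ugr R N ^+ 2 / N.+1%:R * (ugr R j / j.+1%:R) =
      1 * (ugr R j / j.+1%:R) * (ugr R N ^+ 2 * N.+1%:R^-1) by ring.
    apply: ler_pM; rewrite ?mulr_ge0 ?exprn_ge0 ?ugr_ge0 ?cW_ge0 //.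
      by apply: ler_wpM2r.
    by apply: ler_wpM2l; rewrite ?exprn_ge0 ?ugr_ge0 // cW_le_J.
  rewrite -mulr_sumr big_mkord /bnd.
  apply: (@le_trans _ _ (ugr R N ^+ 2 / N.+1%:R * (27 * ugr R N))).
    apply: ler_wpM2l; last exact: sum_ugr.
    by rewrite divr_ge0 ?exprn_ge0 ?ugr_ge0.
  have -> : 27 * (ugr R N ^+ 4 / N.+1%:R) =
    ugr R N ^+ 2 / N.+1%:R * (27 * ugr R N) * ugr R N by ring.
  by rewrite ler_peMr ?ugr_ge1 // !mulr_ge0 ?exprn_ge0 ?ugr_ge0 ?invr_ge0.
Qed.

Let d m : A := if m == 0%N then 1 else X * iv m * G m.

(** Writing 1/(a (b + 1)) = (1/a + 1/(b + 1))/(a + b + 1), the last denominator is at least N + 1 on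
    the range of summation. *)
Lemma tail_harmonic (N b : nat) : (b < N)%N ->
  b.+1%:R^-1 * \sum_(N - b <= a < N.+1) a%:R^-1 <= (27 * ugr R N + 1) / N.+1%:R.
Proof.
move=> bN; rewrite mulr_sumr.
apply: (@le_trans _ _ (\sum_(N - b <= a < N.+1) (a%:R^-1 + b.+1%:R^-1) / N.+1%:R)).
  apply: ler_sum_nat => a /andP[ab _].
  have a0 : 0 < a%:R :> R by rewrite ltr0n; lia.
  have b0 : 0 < b.+1%:R :> R by rewrite ltr0n.
  have N0 : 0 < N.+1%:R :> R by rewrite ltr0n.
  have -> : (a%:R^-1 + b.+1%:R^-1) / N.+1%:R =
    b.+1%:R^-1 * a%:R^-1 * ((a + b.+1)%:R / N.+1%:R) :> R.
    rewrite natrD; field; apply/and3P; split; apply/negPf; apply: gt_eqF; rewrite ?nat1r //.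
  apply: ler_peMr; first by rewrite mulr_ge0 ?invr_ge0.
  by rewrite ler_pdivlMr // mul1r ler_nat; lia.
rewrite -mulr_suml; apply: ler_wpM2r; first by rewrite invr_ge0.
rewrite big_split /= sumr_const_nat; apply: lerD.
  apply: (@le_trans _ _ (\sum_(1 <= a < N.+1) a%:R^-1)).
    rewrite (@big_cat_nat _ _ _ (N - b) 1 N.+1) /=; [|lia|lia].
    by rewrite lerDr sumr_ge0 // => *; rewrite invr_ge0.
  by rewrite big_add1 /= big_mkord; exact: sum_inv.
have -> : (N.+1 - (N - b) = b.+1)%N by lia.
by rewrite -[leLHS]mulr_natr mulVf // pnatr_eq0.
Qed.

(** The difference consists of the products p(a) d(b + 1) with a + b + 1 > N. Of the two factors
    1/(b + 1) bounding d, one is spent on [tail_harmonic] and the other on [sum_ugr]. *)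
Lemma bd_err k :
  bd k (fun N => psum (pinv (1 : dual R)) N.+1 * psum d N.+1
                 - psum (conv (pinv (1 : dual R)) d) N.+1) bnd.
Proof.
set p := pinv _.
apply: (@bd_ext _ _ _ (fun N => \sum_(0 <= b < N)
    d b.+1 * \sum_(N - b <= a < N.+1) p a)) => [N|].
  have -> : conv p d = conv d p by rewrite /conv fps_mulC.
  rewrite psum_conv /conv /fps_mul big_ord_recr /= subnn psum0 mulr0 addr0.
  rewrite [psum d _]/psum mulr_sumr -sumrB big_ord_recl /= subn0 [psum p _ * _]mulrC subrr add0r.
  rewrite big_mkord; apply: eq_bigr => i _.
  rewrite /bump /= add1n subSS [psum p _ * _]mulrC -mulrBr; congr (_ * _).
  rewrite /psum -!(big_mkord xpredT p).
  rewrite (@big_cat_nat _ _ _ (N - i) 0 N.+1) /=; [|lia|lia].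
  by rewrite [X in X - _]addrC addrK.
have H1 : bd k (fun x : nat * nat => d x.2.+1 * \sum_(x.1 - x.2 <= a < x.1.+1) p a)
  (fun x => x.2.+1%:R^-1 * (ugr R x.2 / x.2.+1%:R) * \sum_(x.1 - x.2 <= a < x.1.+1) a%:R^-1).
  apply: bd_mul.
    apply: (@bd_ext _ _ _ (fun x : nat * nat => X * (iv x.2.+1 * G x.2.+1))) => [x|].
      by rewrite /d /= mulrA.
    apply: bd_cmul; apply: bd_mul.
      exact: (bd_comp (fun x : nat * nat => x.2) (bd_invR k)).
    exact: (bd_comp (fun x : nat * nat => x.2) (bd_G k)).
  have := bd_sum (fun x : nat * nat => index_iota (x.1 - x.2) x.1.+1)
    (bd_comp (fun x : nat * nat * nat => x.2) (bd_pinv k 1)).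
  by [].
have := bd_sum (fun N => index_iota 0 N) H1.
apply: (@bd_mono _ _ _ _ _ _ (27 * 28)) => [|N /=]; first by rewrite mulr_ge0.
apply: (@le_trans _ _ (\sum_(0 <= b < N) ((27 * ugr R N + 1) / N.+1%:R) * (ugr R b / b.+1%:R))).
  apply: ler_sum_nat => b /andP[_ bN]; rewrite mulrAC.
  apply: ler_wpM2r; last exact: tail_harmonic.
  by rewrite divr_ge0 ?ugr_ge0.
rewrite -mulr_sumr big_mkord /bnd.
have u1 := ugr_ge1 R N; have u0 := ugr_ge0 R N.
apply: (@le_trans _ _ ((27 * ugr R N + 1) / N.+1%:R * (27 * ugr R N))).
  apply: ler_wpM2l; last exact: sum_ugr.
  by rewrite divr_ge0 //; lra.
have -> : (27 * ugr R N + 1) / N.+1%:R * (27 * ugr R N) =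
   27 * ((27 * ugr R N + 1) * ugr R N) / N.+1%:R by ring.
have -> : 27 * 28 * (ugr R N ^+ 4 / N.+1%:R) = 27 * (28 * ugr R N ^+ 4) / N.+1%:R by ring.
apply: ler_wpM2r; first by rewrite invr_ge0.
apply: ler_wpM2l => //.
apply: (@le_trans _ _ (28 * ugr R N * ugr R N)).
  by rewrite ler_wpM2r //; lra.
have -> : 28 * ugr R N * ugr R N = 28 * ugr R N ^+ 2 by ring.
by rewrite ler_wpM2l // ler_weXn2l.
Qed.
End SumAsymptotics.

(** * Interpolated zeta values as limits of truncated sums *)

Section Interpolated.
Variables (R : realType) (t : R).
Local Open Scope classical_set_scope.

Lemma big_tupleS n (F : seq bool -> R) :
  \sum_(bs : n.+1.-tuple bool) F bs =
  \sum_(bs : n.-tuple bool) F (true :: bs) + \sum_(bs : n.-tuple bool) F (false :: bs).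
Proof.
rewrite (reindex (fun x : bool * n.-tuple bool => [tuple of x.1 :: x.2])) /=; last first.
  exists (fun u => (thead u, [tuple of behead u])) => [[b u] _|u _] /=.
    by rewrite theadE; congr pair; apply: val_inj.
  by rewrite [RHS]tuple_eta; apply: val_inj.
by rewrite -(pair_bigA _ (fun b (bs : n.-tuple bool) => F (b :: bs))) big_bool.
Qed.

Lemma size_compress bs s : (size (compress bs s) <= size s)%N.
Proof.
elim: bs s => [|b bs IH] [|k [|k' s]] //=; case: b => /=.
  by apply: leq_trans (IH _) _ => /=.
by rewrite ltnS; exact: IH.
Qed.

Lemma pos_compress bs s : pos s -> pos (compress bs s).
Proof.
elim: bs s => [|b bs IH] [|k [|k' s]] //= /and3P[k0 k'0 ps]; case: b.
  by apply: IH => /=; rewrite ps addn_gt0 k0.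
by rewrite /= k0; apply: IH; rewrite /= k'0.
Qed.

Lemma head_compress bs s : (1 < head 0 s)%N -> (1 < head 0 (compress bs s))%N.
Proof.
elim: bs s => [|b bs IH] [|k [|k' s]] //= k1; case: b => //.
by apply: IH => /=; apply: leq_trans k1 (leq_addr _ _).
Qed.

(** A plus sign after the first entry corresponds to the diagonal l = m in [st], where the exponents
    add up, and a comma to l < m. *)
Lemma sum_compress_zetaN k s N : pos (k :: s) ->
  \sum_(bs : (size s).-tuple bool) t ^+ (size (k :: s) - size (compress bs (k :: s)))
     * zetaN R (compress bs (k :: s)) N
  = \sum_(1 <= m < N.+1) st t (k :: s) m.
Proof.
elim: s k N => [|k' s IH] k N ps.
  rewrite (big_pred1 [tuple]) => [|bs]; last by apply/esym/eqP/val_inj; case: bs => [[]].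
  rewrite /= subnn expr0 mul1r; apply: eq_big_nat => m /andP[m0 _].
  rewrite [(m == 0%N)]gtn_eqF // mulr0 addr0; congr (_ * _).
  by case: m m0 => // m _; rewrite big_ord_recl /= big1 ?addr0.
have /and3P[k0 k'0 ps'] := ps.
rewrite (@big_tupleS (size s) (fun bs => t ^+ (size [:: k, k' & s] -
   size (compress bs [:: k, k' & s])) * zetaN R (compress bs [:: k, k' & s]) N)).
have -> : \sum_(1 <= m < N.+1) st t [:: k, k' & s] m =
   t * (\sum_(1 <= m < N.+1) st t ((k + k')%N :: s) m) +
   \sum_(1 <= m < N.+1) (m%:R ^- k * \sum_(1 <= l < m.-1.+1) st t (k' :: s) l).
  rewrite mulr_sumr -big_split /=; apply: eq_big_nat => m /andP[m0 _].
  have mn0 : (m%:R : R) != 0 by rewrite pnatr_eq0 -lt0n.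
  rewrite -/(st t (k' :: s)) prednK //.
  have -> : \sum_(l < m) st t (k' :: s) l = \sum_(1 <= l < m) st t (k' :: s) l.
    by rewrite -(big_mkord xpredT) big_ltn // st0 ?add0r //= k'0.
  rewrite -/(st t (k' :: s) m) [st t (k' :: s) m]/= exprD invfM; ring.
congr (_ + _).
  rewrite -IH /= ?ps' ?addn_gt0 ?k0 // mulr_sumr; apply: eq_bigr => bs _.
  have := size_compress bs ((k + k')%N :: s) => /= H.
  by rewrite subSn // exprS mulrA.
under [RHS]eq_bigr => m _ do rewrite -IH /= ?k'0 //.
under [RHS]eq_bigr do rewrite mulr_sumr.
rewrite exchange_big /=; apply: eq_bigr => bs _; rewrite subSS mulr_sumr.
by apply: eq_bigr => m _; rewrite mulrCA.
Qed.

Lemma zetaN_ge0 s N : 0 <= zetaN R s N.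
Proof.
elim: s N => [|k s IH] N //=; apply: sumr_ge0 => m _.
by rewrite mulr_ge0 // invr_ge0 exprn_ge0.
Qed.

Lemma zetaN_le_ugr s N : pos s -> zetaN R s N <= 27 ^+ size s * ugr R N.
Proof.
elim: s N => [|k s IH] N /=; first by rewrite mul1r ugr_ge1.
move=> /andP[k0 ps]; rewrite exprS mulrAC.
apply: (@le_trans _ _ (\sum_(1 <= m < N.+1) 27 ^+ size s * (ugr R m.-1 / m%:R))).
  apply: ler_sum_nat => m /andP[m0 _].
  have mp : 0 < m%:R :> R by rewrite ltr0n.
  have -> : 27 ^+ size s * (ugr R m.-1 / m%:R) = m%:R^-1 * (27 ^+ size s * ugr R m.-1).
    by ring.
  apply: ler_pM; [by rewrite invr_ge0 exprn_ge0|exact: zetaN_ge0| |exact: IH].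
  rewrite lef_pV2 ?posrE ?exprn_gt0 //; case: k k0 => // k _.
  by rewrite exprS ler_peMr // exprn_ege1 // ler1n.
rewrite -mulr_sumr [leLHS]mulrC; apply: ler_wpM2r; first exact: exprn_ge0.
by rewrite big_add1 /= big_mkord; exact: sum_ugr.
Qed.

(** The right side is a telescoping majorant: its increments dominate the terms, and it stays below
    3. *)
Lemma sum_ugr_sqr N : \sum_(1 <= m < N.+1) ugr R m.-1 / m%:R ^+ 2 <= 3 * (1 - ugr R N / N.+1%:R).
Proof.
elim: N => [|N IH]; first by rewrite big_geq // /ugr big_ord0 divr1 subrr mulr0.
rewrite big_nat_recr //=; apply: (le_trans (lerD IH (lexx _))); rewrite ugrS.
rewrite -[N.+2%:R]natr1; have : 1 <= N.+1%:R :> R by rewrite ler1n.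
have := ugr_ge0 R N; move: (ugr R N) (N.+1%:R : R) => u n u0 n1.
rewrite -subr_ge0.
have -> : 3 * (1 - (u + 27^-1 * (u / n)) / (n + 1)) - (3 * (1 - u / n) + u / n ^+ 2) =
  u * (17 * n - 9) / (9 * n ^+ 2 * (n + 1)).
  by field; apply/andP; split; apply/eqP; lra.
by rewrite divr_ge0 // !mulr_ge0 ?sqr_ge0 //; lra.
Qed.

Lemma zetaN_cvg s : pos s -> (1 < head 0 s)%N -> cvgn (zetaN R s).
Proof.
case: s => [//|k s] /= /andP[_ ps] k1; apply: nondecreasing_is_cvgn.
  apply: homo_leq => // [a b c|N]; first exact: le_trans.
  by rewrite [leRHS]big_nat_recr //= lerDl mulr_ge0 ?zetaN_ge0 // invr_ge0 exprn_ge0.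
exists (27 ^+ size s * 3) => _ [N _ <-] /=.
apply: (@le_trans _ _ (\sum_(1 <= m < N.+1) 27 ^+ size s * (ugr R m.-1 / m%:R ^+ 2))).
  apply: ler_sum_nat => m /andP[m0 _]; have mp : 0 < m%:R :> R by rewrite ltr0n.
  rewrite mulrA [leRHS]mulrC.
  apply: ler_pM; [by rewrite invr_ge0 exprn_ge0|exact: zetaN_ge0| |].
    rewrite lef_pV2 ?posrE ?exprn_gt0 //; case: k k1 => [//|[//|k]] _.
    by rewrite ler_weXn2l ?ler1n.
  exact: zetaN_le_ugr.
rewrite -mulr_sumr ler_wpM2l ?exprn_ge0 //; apply: le_trans (sum_ugr_sqr N) _.
have : 0 <= ugr R N / N.+1%:R by rewrite divr_ge0 ?ugr_ge0.
by move: (ugr R N / N.+1%:R) => w; lra.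
Qed.

Lemma cvg_sumr (I : eqType) (r : seq I) (f : I -> nat -> R) (a : I -> R) :
  (forall i, i \in r -> f i N @[N --> \oo] --> a i) ->
  (\sum_(i <- r) f i N) @[N --> \oo] --> \sum_(i <- r) a i.
Proof.
elim: r => [|i r IH] fa.
  by rewrite big_nil; under eq_fun do rewrite big_nil; exact: cvg_cst.
rewrite big_cons; under eq_fun do rewrite big_cons.
apply: cvgD; first by apply: fa; rewrite mem_head.
by apply: IH => l lr; apply: fa; rewrite inE lr orbT.
Qed.

Lemma zetat_cvg s : pos s -> (1 < head 0 s)%N ->
  (\sum_(1 <= m < N.+1) st t s m) @[N --> \oo] --> zetat t s.
Proof.
case: s => [//|k s] ps k1.
under eq_fun => N do rewrite -sum_compress_zetaN //.
apply: cvg_sumr => bs _; apply: cvgMl_tmp.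
by apply: zetaN_cvg; [exact: pos_compress|exact: head_compress].
Qed.
End Interpolated.

(** * The generating identity for a fixed real y *)

Section GeneratingIdentity.
Variables (R : realType) (t y : R).
Local Notation D := (dual R).
Local Notation A := (fps (dual R)).
Local Notation X := (fpsX R).
Local Notation t' := (fpsR t).
Local Notation y' := (fpsR y).
Local Notation eps := (fps_eps R).
Local Notation iv m := (fpsR (m%:R : R)^-1).
Local Open Scope classical_set_scope.

(** The complete homogeneous symmetric polynomial of degree k in two variables; by [coef_pinv_mul]
    it is the numerator in the coefficients of 1/((j - z)(j - v)). *)
Definition homsum (B : pzRingType) k (b a : B) : B := \sum_(i < k.+1) b ^+ i * a ^+ (k - i).

Lemma coef_pinv_mul (b a : D) j k :
  (pinv b j * pinv a j) k = homsum k b a * dre (j%:R ^- k.+2).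
Proof.
rewrite fps_coef_mul /homsum mulr_suml; apply: eq_bigr => i _.
rewrite /pinv mulrACA -dreM -invfM -exprD; congr (_ * dre (_ ^- _)).
by have := ltn_ord i; lia.
Qed.

Lemma zetaN1 k N : \sum_(1 <= j < N.+1) j%:R ^- k = zetaN R [:: k] N.
Proof. by apply: eq_bigr => j _; rewrite mulr1. Qed.

Lemma coef_sum_pinv_mul (b a : D) N k :
  (\sum_(1 <= j < N.+1) pinv b j * pinv a j) k = homsum k b a * dre (zetaN R [:: k.+2] N).
Proof.
rewrite fps_coef_sum -zetaN1 dre_sum mulr_sumr.
by apply: eq_bigr => j _; exact: coef_pinv_mul.
Qed.

(* The eps-part differentiates along alpha' = (1 - t) y, beta' = y. *)
Definition alpha_eps : D := (1 + t * y, (1 - t) * y).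
Definition beta_eps : D := (y, y).
Local Notation al2 := alpha_eps.
Local Notation be2 := beta_eps.
Local Notation al0 := (dre (1 + t * y)).
Local Notation be0 := (dre y).

Let z := y' * X.
Let v := X + t' * z.
Lemma vE0 : v = cst al0 * X.
Proof.
by rewrite -/(fpsR (1 + t * y)) fpsRD fpsR1 fpsRM /v /z; ring.
Qed.

Lemma vE2 : v + eps * (1 - t') * z = cst al2 * X.
Proof.
have -> : al2 = dre (1 + t * y) + deps R * dre ((1 - t) * y).
  by congr pair; rewrite /=; ring.
rewrite vE0 cstD cstM -/eps -/(fpsR ((1 - t) * y)) /z.
by rewrite fpsRM [fpsR (1 - t)]fpsRD fpsRN fpsR1; ring.
Qed.

Lemma zE2 : z + eps * z = cst be2 * X.
Proof.
have -> : be2 = dre y + deps R * dre y by congr pair; rewrite /=; ring.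
by rewrite cstD cstM /z -/eps -/y'; ring.
Qed.

Lemma pinv0 (a : D) : pinv a 0 = 0.
Proof. by apply/funext => k; rewrite /pinv exprS mul0r invr0 dre0 mulr0. Qed.

Let qw := pinv (dre (2 + t * y)).

Lemma qwE m : (0 < m)%N -> (m%:R - (X + v)) * qw m = 1.
Proof.
move=> m0; have E := pinvE (dre (2 + t * y)) m0; rewrite -[RHS]E; congr ((_ - _) * _).
by rewrite -/(fpsR (2 + t * y)) fpsRD fpsRM (fpsR_nat R 2) /v /z; ring.
Qed.

Let p := pinv (1 : D).
Let G := Gc t (yc y).
Let h := Gc t (Vc t y).
Let kappa m := fpsR (t * (1 - t) * y ^+ 2) * Gc t (Bc y) m.
Let Gd m := if m == 0%N then 0 else
  kappa m + z * G m * psum p m + G m + (1 - t') * z * G m * p m.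
Let G2 m := G m + eps * Gd m.
Let d m := if m == 0%N then 1 else X * iv m * G m.
Let err N := psum p N.+1 * psum d N.+1 - psum (conv p d) N.+1.
Let cfin (q : seq nat) : R := adm (fun q => Vc t y q - Uc t y q) q
  + adm (fun q => t * (1 - t) * y ^+ 2 * (y ^+ size q * (bk q)%:R)) q.

(** Multiplying by [eps] replaces G' by the difference of [G2] and [G], to each of which the sum
    formula applies. *)
Lemma eps_sum_G N : eps * \sum_(1 <= m < N.+1) Gc t cfin m =
  X * (\sum_(1 <= m < N.+1) iv m * G2 m) - X * (\sum_(1 <= m < N.+1) iv m * G m)
  - eps * t' * y' * X * (\sum_(1 <= m < N.+1) iv m * G m)
  + eps * t' * y' * z * (\sum_(1 <= m < N.+1) iv m)
  - eps * t' * y' * z * (\sum_(1 <= m < N.+1) p m)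
  - eps * t' * z ^+ 2 * (\sum_(1 <= m < N.+1) p m * p m)
  - eps * z * err N.
Proof.
have -> : \sum_(1 <= m < N.+1) Gc t cfin m =
    \sum_(1 <= m < N.+1) (h m - z * p m * (psum h m + t' * h m)
           - iv m * (z * (psum G m + t' * G m) - t' * y' * z) + X * iv m * kappa m).
  apply: eq_big_nat => m /andP[m0 _].
  by rewrite GcD Gc_adm_weight // Gc_adm_bk.
have pinv1E' m : (0 < m)%N -> (m%:R - X) * p m = 1 by exact: pinv1E.
have E := @weighted_sum_finite A X t' y' G h kappa p (fun m => iv m) qw pinv1E' (pinv0 1)
  (@fpsR_inv R) qwE (Gc_yc0 t y) (@Gc_yc_rec R t y) (Gc_Vc0 t y) (@Gc_Vc_rec R t y) N.
rewrite {}E -/(err N) mulrBr; congr (_ - _); last by rewrite /z; ring.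
rewrite !mulr_sumr -!sumrB -big_split -!sumrB /=.
apply: eq_big_nat => m /andP[m0 _].
by rewrite /G2 /Gd gtn_eqF // /z; ring.
Qed.

Let S2 N := \sum_(1 <= j < N.+1) pinv be2 j * pinv al2 j.
Let S0 N := \sum_(1 <= j < N.+1) pinv be0 j * pinv al0 j.
Let D2 N := \sum_(1 <= m < N.+1) iv m * G2 m - cst be2 * X * S2 N.
Let D0 N := \sum_(1 <= m < N.+1) iv m * G m - cst be0 * X * S0 N.
Let Err N := X * D2 N + (- (X + eps * t' * y' * X)) * D0 N + (- (eps * z)) * err N.

Lemma GE_al0 m : (0 < m)%N -> (m%:R - cst al0 * X) * G m = cst be0 * X * psum G m.
Proof. by move=> m0; rewrite -vE0; exact: Gc_yc_rec. Qed.

Lemma Err_cvg k : (Err N k).2 @[N --> \oo] --> (0 : R).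
Proof.
apply: bd_cvg; apply: bd_add; first apply: bd_add; apply: bd_cmul.
- apply: sum_formula_asymptotic => [|m m0].
    by rewrite /G2 /Gd /= mulr0 addr0; exact: Gc_yc0.
  rewrite -vE2 -zE2.
  exact: (@perturbed_rec A X t' y' eps G kappa p (@pinv1E R) (pinv0 1) (Gc_yc0 t y)
    (@Gc_yc_rec R t y) (kappa_at0 t y) (@kappa_rec R t y) (fps_eps2 R) m m0).
- by apply: sum_formula_asymptotic; [exact: Gc_yc0|exact: GE_al0].
- by apply: (@bd_err R al0 be0 G); [exact: Gc_yc0|exact: GE_al0].
Qed.

(** The [eps] component in weight K + 2, as N grows. The derivative and the value of the sum formula
    give the first two terms; the sums of p and of its square contribute 1 and K + 1 times the zeta
    value, hence the factor [K.+2]. *)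
Lemma generating_identity K :
  \sum_(q <- comps K.+2) cfin q * zetat t q =
  ((be2 * homsum K be2 al2).2 - t * y * (y * homsum K y (1 + t * y))
   - t * y ^+ 2 * K.+2%:R) * mzv R [:: K.+2].
Proof.
set c := (X in X * mzv _ _).
have key N : \sum_(q <- comps K.+2) cfin q * (\sum_(1 <= m < N.+1) st t q m) =
    c * zetaN R [:: K.+2] N + (Err N K.+2).2.
  have E0 : eps * \sum_(1 <= m < N.+1) Gc t cfin m =
      cst be2 * (X * (X * S2 N)) - cst be0 * (X * (X * S0 N))
      - cst (deps R * dre (t * y * y)) * (X * (X * S0 N))
      + cst (deps R * dre (t * y * y)) * (X * \sum_(1 <= m < N.+1) iv m)
      - cst (deps R * dre (t * y * y)) * (X * \sum_(1 <= m < N.+1) p m)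
      - cst (deps R * dre (t * y * y)) * (X * (X * \sum_(1 <= m < N.+1) p m * p m))
      + Err N.
    rewrite eps_sum_G /Err /D2 /D0 cstM -/eps -/(fpsR (t * y * y)) !fpsRM /z
      -/(fpsR y).
    by ring.
  have cXX a (f : A) : (cst a * (X * (X * f))) K.+2 = a * f K.
    by rewrite fps_coef_cstM !fps_coef_XMS.
  have cX a (f : A) : (cst a * (X * f)) K.+2 = a * f K.+1.
    by rewrite fps_coef_cstM fps_coef_XMS.
  have coefL (a1 a2 a3 a4 a5 a6 a7 : A) k (b1 b2 b3 b4 b5 b6 : D) :
      a1 k = b1 -> a2 k = b2 -> a3 k = b3 -> a4 k = b4 -> a5 k = b5 -> a6 k = b6 ->
    (a1 - a2 - a3 + a4 - a5 - a6 + a7) k = b1 - b2 - b3 + b4 - b5 - b6 + a7 k.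
    by move=> <- <- <- <- <- <-.
  set Z := zetaN R [:: K.+2] N; pose e := deps R * dre (t * y * y).
  have E : deps R * dre (\sum_(q <- comps K.+2) cfin q * \sum_(1 <= m < N.+1) st t q m) =
      be2 * (homsum K be2 al2 * dre Z) - dre y * (dre (homsum K y (1 + t * y)) * dre Z)
      - e * (dre (homsum K y (1 + t * y)) * dre Z) + e * 0 - e * dre Z
      - e * (dre K.+1%:R * dre Z) + Err N K.+2.
    transitivity ((eps * \sum_(1 <= m < N.+1) Gc t cfin m) K.+2).
      rewrite fps_coef_cstM; congr (_ * _); rewrite fps_coef_sum /Gc -dre_sum exchange_big /=.
      by congr dre; apply: eq_bigr => q _; rewrite mulr_sumr.
    rewrite E0.
    have hs0 : homsum K be0 al0 = dre (homsum K y (1 + t * y)).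
      by rewrite /homsum dre_sum; apply: eq_bigr => i _; rewrite dreM !dreX.
    have hs1 : homsum K (1 : D) 1 = dre K.+1%:R.
      rewrite /homsum; under eq_bigr do rewrite !expr1n mulr1.
      by rewrite sumr_const card_ord dre_nat.
    apply: coefL.
    - by rewrite cXX /S2 coef_sum_pinv_mul.
    - by rewrite cXX /S0 coef_sum_pinv_mul hs0.
    - by rewrite cXX /S0 coef_sum_pinv_mul hs0.
    (* The series 1/m is constant in X, so the harmonic sum enters in weight 1 only. *)
    - by rewrite cX fps_coef_sum big1.
    - rewrite cX fps_coef_sum /Z -zetaN1 dre_sum; congr (_ * _); apply: eq_bigr => m _.
      by rewrite /p /pinv expr1n mul1r.
    - by rewrite cXX coef_sum_pinv_mul hs1.
  move: E; rewrite {}/e {}/c {}/Z {E0 cXX cX coefL}.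
  move: (\sum_(q <- _) _) (Err N K.+2) (homsum K be2 al2) (homsum K y _) (zetaN _ _ _).
  move=> s er [h1 h2] h0 Z /(congr1 snd) /= E.
  (* The left factor is the second component of [eps] times a real number, as the dual product
     computes it. *)
  transitivity (0 * 0 + 1 * s); first by ring.
  by rewrite {}E -[K.+2%:R]natr1; ring.
have L1 : (\sum_(q <- comps K.+2) cfin q * \sum_(1 <= m < N.+1) st t q m) @[N --> \oo]
   --> \sum_(q <- comps K.+2) cfin q * zetat t q.
  apply: cvg_sumr => q; rewrite mem_comps => /andP[pq _].
  have [q1|q1] := boolP (1 < head 0 q)%N.
    by apply: cvgMl_tmp; exact: zetat_cvg.
  rewrite /cfin /adm (negPf q1) addr0 mul0r.
  by under eq_fun do rewrite mul0r; exact: cvg_cst.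
have L2 : (\sum_(q <- comps K.+2) cfin q * \sum_(1 <= m < N.+1) st t q m) @[N --> \oo]
   --> c * mzv R [:: K.+2].
  under eq_fun do rewrite key.
  rewrite -[c * mzv _ _]addr0.
  by apply: cvgD; [apply: cvgMl_tmp; exact: zetaN_cvg|exact: Err_cvg].
exact: cvg_unique L1 L2.
Qed.
End GeneratingIdentity.

(** * The generating identity as a polynomial identity in y *)

Lemma poly_eq_horner (R : numDomainType) (P Q : {poly R}) :
  (forall y, P.[y] = Q.[y]) -> P = Q.
Proof.
move=> PQ; apply/eqP; rewrite -subr_eq0; apply/eqP.
apply: (@roots_geq_poly_eq0 _ _ [seq i%:R | i <- iota 0 (size (P - Q))]).
- by apply/allP => y _; rewrite /root !hornerE PQ subrr.
- rewrite map_inj_uniq ?iota_uniq // => i j /eqP; rewrite eqr_nat; exact: eqP.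
- by rewrite size_map size_iota.
Qed.

Section SigmaPoly.
Variables (R : realType) (t : R) (K : nat).
Local Notation a := (1 + t *: 'X : {poly R}).

Definition sigma_poly : {poly R} := \sum_(i < K.+1) 'X^(i.+1) * a ^+ (K - i).
Definition dsigma_poly : {poly R} := \sum_(i < K.+1)
  ('X^(i.+1) * ((K - i)%:R *: (a ^+ (K - i).-1 * ((1 - t) *: 'X)))
   + i.+1%:R *: ('X^(i.+1) * a ^+ (K - i))).

Lemma coef_alpha_exp m j : (a ^+ m)`_j = 'C(m, j)%:R * t ^+ j.
Proof.
elim: m j => [|m IH] j; first by rewrite expr0 coef1 bin0n; case: j => [|j]; rewrite /= ?mul0r ?mul1r.
rewrite exprS mulrDl mul1r -scalerAl coefD coefZ coefXM IH.
case: j => [|j]; first by rewrite !bin0 mulr0 addr0.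
by rewrite IH binS natrD exprS /=; ring.
Qed.

Lemma sigma_coef0 : sigma_poly`_0 = 0.
Proof. by rewrite /sigma_poly coef_sum big1 // => i _; rewrite coefXnM. Qed.

(** With a = 1 + t X, the geometric sum gives (a - X) sigma = X (a^(K+1) - X^(K+1)), and a - X = 1 -
    (1 - t) X. *)
Lemma sigma_coefS n : (n < K.+1)%N ->
  sigma_poly`_n.+1 = (1 - t) * sigma_poly`_n + 'C(K.+1, n)%:R * t ^+ n.
Proof.
move=> nK.
have E : sigma_poly = (1 - t) *: ('X * sigma_poly) + 'X * (a ^+ K.+1 - 'X^(K.+1)).
  have -> : sigma_poly = 'X * \sum_(i < K.+1) a ^+ (K.+1.-1 - i) * 'X^i.
    rewrite mulr_sumr; apply: eq_bigr => i _.
    by rewrite exprS mulrA mulrAC -mulrA.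
  by rewrite subrXX /= -!mul_polyC polyCB; ring.
rewrite {1}E coefD coefZ !coefXM /= coefB coef_alpha_exp coefXn.
by rewrite ltn_eqF // subr0.
Qed.

(** Regard sigma as S(alpha, beta), homogeneous of degree K + 1. Along alpha = 1 + t y, beta = y,
    the Euler relation gives dS/dalpha = (K + 1) sigma - y sigma'; since alpha' is (1 - t) y instead
    of t y, the dual derivative is y sigma' plus (1 - 2 t) y dS/dalpha. *)
Lemma dsigmaE : dsigma_poly = 'X * sigma_poly^`() +
  ((1 - t) - t) *: ('X * (K.+1%:R *: sigma_poly - 'X * sigma_poly^`())).
Proof.
rewrite /dsigma_poly /sigma_poly (big_morph _ (@derivD R) (deriv0 R)) scaler_sumr !mulr_sumr -sumrB.
rewrite mulr_sumr scaler_sumr -big_split /=; apply: eq_bigr => i _.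
have iK := ltn_ord i.
have -> : K.+1%:R = i.+1%:R + (K - i)%:R :> R by rewrite -natrD; congr _%:R; lia.
have da : a^`() = t%:P by rewrite derivD derivZ derivX -[1]/(1%:P) derivC add0r alg_polyC.
rewrite derivM derivXn deriv_exp da /= -!mul_polyC.
rewrite !(polyCB, polyCD) !polyC_natr polyC1 ![in RHS](mulrnAr, mulrnAl) !exprS.
case: (K - i)%N => [|j] /=; rewrite ?expr0 ?exprS.
  by move: ('X^i : {poly R}) => Y; ring.
by move: ('X^i : {poly R}) (_ ^+ j) => Y B; ring.
Qed.
Lemma dsigma_coef n :
  dsigma_poly`_n.+1 = n.+1%:R * sigma_poly`_n.+1
    + ((1 - t) - t) * ((K.+1%:R - n%:R) * sigma_poly`_n).
Proof.
rewrite dsigmaE coefD coefZ !coefXM /= coefB coefZ coefXM !coef_deriv.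
by case: n => [|n]; rewrite ?sigma_coef0 ?coef_deriv /=; ring.
Qed.

Lemma sigma_horner y : sigma_poly.[y] = y * homsum K y (1 + t * y).
Proof.
rewrite horner_sum mulr_sumr; apply: eq_bigr => i _.
by rewrite hornerM hornerXn horner_exp !hornerE exprS.
Qed.

Lemma dsigma_horner y :
  dsigma_poly.[y] = (beta_eps y * homsum K (beta_eps y) (alpha_eps t y)).2.
Proof.
have bX i : beta_eps y ^+ i = (y ^+ i, i%:R * y ^+ i) :> dual R.
  elim: i => [|i IH]; first by rewrite !expr0 mul0r.
  by rewrite !exprS IH; congr pair; rewrite /= -natr1; ring.
have aX j : alpha_eps t y ^+ j = ((1 + t * y) ^+ j, j%:R * (1 + t * y) ^+ j.-1 * ((1 - t) * y))
    :> dual R.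
  elim: j => [|j IH]; first by rewrite !expr0 !mul0r.
  rewrite !exprS IH; congr pair; rewrite /= -natr1.
  by case: j {IH} => [|j]; rewrite /= ?exprS; ring.
have sum2 I (r : seq I) (F : I -> dual R) : (\sum_(i <- r) F i).2 = \sum_(i <- r) (F i).2.
  exact: (big_morph (fun u : dual R => u.2)).
rewrite horner_sum mulr_sumr sum2; apply: eq_bigr => i _.
by rewrite mulrA -exprS bX aX /= !hornerE.
Qed.

Lemma sigma_sum n : (n <= K)%N ->
  sigma_poly`_n.+1 = \sum_(0 <= i < n.+1) 'C(K.+1, i)%:R * t ^+ i * (1 - t) ^+ (n - i).
Proof.
elim: n => [|n IH] nK.
  by rewrite sigma_coefS // sigma_coef0 big_nat1 bin0 /= !expr0; ring.
rewrite sigma_coefS // IH 1?ltnW // [RHS]big_nat_recr //= subnn expr0 mulr1; congr (_ + _).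
rewrite mulr_sumr; apply: eq_big_nat => i /andP[_ lei].
by rewrite subSn // exprS; ring.
Qed.
End SigmaPoly.

(** * Comparison of the coefficients of y^n *)

Lemma sum_I0E (M : nmodType) k n (F : seq nat -> M) :
  sum_I0 k n F = \sum_(q <- comps k | (1 < head 0 q)%N && (size q == n)) F q.
Proof.
rewrite /sum_I0 -big_filter -(big_map (fun s : n.-tuple 'I_k.+1 => map val s) xpredT F).
rewrite -[RHS]big_filter; apply: perm_big; apply: uniq_perm.
- rewrite map_inj_uniq ?filter_uniq ?index_enum_uniq // => s s' /(inj_map val_inj).
  exact: val_inj.
- exact: filter_uniq (uniq_comps k).
move=> q; rewrite mem_filter mem_comps; apply/mapP/idP.
  move=> [s]; rewrite mem_filter => /andP[/and3P[ps sk h2] _] ->.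
  by rewrite h2 ps sk size_map size_tuple eqxx.
move=> /andP[/andP[h2 /eqP sq] /andP[pq /eqP sk]].
have lek : all (fun i => i < k.+1)%N q.
  rewrite -sk; elim: (q) => //= i s IH; apply/andP; split; first by lia.
  by apply: sub_all IH => j /=; lia.
have Es : size (map (@inord k) q) == n by rewrite size_map sq.
have Eq : map val (Tuple Es) = q.
  rewrite /= -map_comp map_id_in // => i iq /=.
  by rewrite inordK // (allP lek).
exists (Tuple Es) => //; rewrite mem_filter mem_index_enum andbT Eq.
by rewrite /isI0 pq sk eqxx.
Qed.
Arguments comps : simpl never.

Lemma zetat1 (R : realType) (t : R) k : zetat t [:: k] = mzv R [:: k].
Proof.
rewrite /zetat /= (big_pred1 [tuple]) => [|bs].
  by rewrite subnn expr0 mul1r.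
by apply/esym/eqP/val_inj; case: bs => [[]].
Qed.

(* The convention [Ctt [:: k] = k] is not the one under which the generating
   function is computed; the last term accounts for the difference. *)
Lemma weightE (R : realType) (t y : R) q : pos q -> (1 < head 0 q)%N ->
  adm (fun q => Vc t y q - Uc t y q) q
    + adm (fun q => t * (1 - t) * y ^+ 2 * (y ^+ size q * (bk q)%:R)) q
  = Ctt R q * y ^+ size q - t * (Ct R q - Ctt R q) * y ^+ (size q).+1
    + (t - t ^+ 2) * (bk q)%:R * y ^+ (size q).+2
    - (size q == 1%N)%:R * (y * ((head 0%N q)%:R - 1) + t * y ^+ 2 * (head 0%N q)%:R).
Proof.
move=> pq h2; rewrite /adm h2; move: (bk q) => b.
case: q pq h2 => [//|k [|k' s]] pq _.
  rewrite /Uc /Vc /chop /Ctt /Ct /= Cc_nil.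
  by move: (Cc [:: k]) => c; ring.
rewrite /Uc /Vc /Ctt /Ct /chop /=.
move: (Cc _) (Cc _) (Cc _) (Cc _) => c1 c2 c3 c4.
by rewrite !exprS; move: (y ^+ size s) => Y; ring.
Qed.

Lemma filter_comps_size1 k : (0 < k)%N -> [seq q <- comps k | size q == 1%N] = [:: [:: k]].
Proof.
move=> k0; apply: perm_small_eq => //; apply: uniq_perm => // [|q].
  exact: filter_uniq (uniq_comps k).
rewrite mem_filter mem_comps inE; apply/idP/eqP => [|->].
  by case: q => [//|a [|//]] /andP[_ /andP[_ /eqP <-]] /=; rewrite addn0.
by rewrite /= k0 addn0 eqxx.
Qed.

Theorem theorem3p11 (R : realType) (k n : nat) (t : R) :
  (2 <= n)%N -> (n < k)%N ->
  sum_I0 k n (fun s => Ctt R s * zetat t s)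
  - t * sum_I0 k n.-1 (fun s => (Ct R s - Ctt R s) * zetat t s)
  + (t - t ^+ 2) * sum_I0 k n.-2 (fun s => (bk s)%:R * zetat t s)
  = ((\sum_(1 <= i < n.-1)
        ((k * 'C(k.-1, i))%:R - ((k - n + 1) * 'C(k.-1, i.-1))%:R)
          * t ^+ i * (1 - t) ^+ (n - 1 - i))
     + k%:R * (1 - t) ^+ n.-1 + ('C(k.-1, n.-1))%:R * t ^+ n.-1)
    * mzv R [:: k].
Proof.
case: n => [//|[//|n]] _; case: k => [//|[//|K]] nK; set k := K.+2; rewrite !subn1 /=.
set zk := mzv R [:: k].
pose c1 q := Ctt R q * zetat t q.
pose c2 q := t * ((Ct R q - Ctt R q) * zetat t q).
pose c3 q := (t - t ^+ 2) * ((bk q)%:R * zetat t q).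
pose P : {poly R} := \sum_(q <- comps k | (1 < head 0 q)%N)
  (c1 q *: 'X^(size q) - c2 q *: 'X^((size q).+1) + c3 q *: 'X^((size q).+2)).
(* The length-one correction of [weightE] cancels the term t y^2 (K + 2) of the generating identity
   and leaves the linear term (K + 1) y. *)
pose Q : {poly R} := zk *: (dsigma_poly t K - t *: ('X * sigma_poly t K) + K.+1%:R *: 'X).
have PQ : P = Q.
  apply: poly_eq_horner => y.
  have E := generating_identity t y K.
  have E1 : P.[y] = \sum_(q <- comps k)
     (adm (fun q => Vc t y q - Uc t y q) q
      + adm (fun q => t * (1 - t) * y ^+ 2 * (y ^+ size q * (bk q)%:R)) q) * zetat t q
     + \sum_(q <- comps k | size q == 1%N)
      (y * ((head 0%N q)%:R - 1) + t * y ^+ 2 * (head 0%N q)%:R) * zetat t q.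
    rewrite /P horner_sum [LHS]big_mkcond [X in _ = _ + X]big_mkcond -big_split /=.
    rewrite !big_seq; apply: eq_bigr => q; rewrite mem_comps => /andP[pq /eqP sq].
    case: ifP => h2.
      rewrite weightE // !(hornerD, hornerN, hornerZ, hornerXn) /c1 /c2 /c3.
      move: (y ^+ size q) (y ^+ (size q).+1) (y ^+ (size q).+2) => u1 u2 u3.
      by case: eqP => _ /=; ring.
    rewrite /adm h2 addr0 mul0r add0r; case: eqP => // q1.
    by case: q q1 sq h2 {pq} => [//|a [|//]] _; rewrite /k /=; lia.
  rewrite E1 {}E -big_filter filter_comps_size1 // big_seq1 zetat1 /Q.
  rewrite !(hornerD, hornerN, hornerZ, hornerM, hornerX) dsigma_horner sigma_horner.
  rewrite -/k -/zk [head _ _]/= /k -[K.+2%:R]natr1.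
  by move: (snd _) (homsum K y _) => u1 u2; ring.
have /(congr1 (fun p : {poly R} => p`_n.+2)) := PQ.
have -> : P`_n.+2 = sum_I0 k n.+2 c1 - sum_I0 k n.+1 c2 + sum_I0 k n c3.
  rewrite !sum_I0E /P coef_sum ![in RHS]big_mkcondr /= -sumrB -big_split /=.
  apply: eq_bigr => q _; rewrite coefD coefB !coefZ !coefXn !eqSS ![n.+2 == _]eq_sym.
  rewrite ![_ == size q]eq_sym.
  by do 3!case: eqP => _; rewrite ?mulr1 ?mulr0.
have sumZ m c (F : seq nat -> R) : sum_I0 k m (fun q => c * F q) = c * sum_I0 k m F.
  by rewrite /sum_I0 mulr_sumr.
rewrite /c2 /c3 !sumZ => ->.
rewrite /Q coefZ mulrC; congr (_ * _).
rewrite coefD coefB !coefZ coefXM coefX /= mulr0 addr0 dsigma_coef.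
have nK' : (n < K)%N by [].
have S3 := @sigma_coefS R t K n.+1 nK'.
pose A1 := \sum_(1 <= i < n.+1) 'C(K.+1, i)%:R * t ^+ i * (1 - t) ^+ (n.+1 - i).
pose A2 := \sum_(1 <= i < n.+1) 'C(K.+1, i.-1)%:R * t ^+ i * (1 - t) ^+ (n.+1 - i).
have S1 : (sigma_poly t K)`_n.+2 =
    (1 - t) ^+ n.+1 + A1 + 'C(K.+1, n.+1)%:R * t ^+ n.+1.
  rewrite sigma_sum // big_ltn // big_nat_recr //= subnn subn0 bin0 !expr0 -/A1.
  by ring.
have S2 : t * (sigma_poly t K)`_n.+1 = A2 + 'C(K.+1, n)%:R * t ^+ n.+1.
  rewrite sigma_sum ?(ltnW nK') // big_nat_recr //= subnn expr0 mulr1 mulrDr mulr_sumr.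
  rewrite /A2 big_add1 /=; congr (_ + _); last by rewrite exprS; ring.
  by apply: eq_bigr => i _; rewrite subSS exprS; ring.
have -> : \sum_(1 <= i < n.+1) ((k * 'C(K.+1, i))%:R -
    ((k - n.+2 + 1) * 'C(K.+1, i.-1))%:R) * t ^+ i * (1 - t) ^+ (n.+1 - i) =
    k%:R * A1 - (k - n.+2 + 1)%:R * A2.
  rewrite !mulr_sumr -sumrB; apply: eq_bigr => i _.
  by rewrite !natrM; ring.
(* This absorption identity reconciles the end terms i = n - 1 of the two coefficient sums with the
   single binomial in the statement. *)
have B : (k - n.+2 + 1)%:R * 'C(K.+1, n)%:R = n.+1%:R * 'C(K.+1, n.+1)%:R :> R.
  by rewrite -!natrM mul_bin_left; congr (_ * _)%:R; rewrite /k; lia.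
have knE : (k - n.+2 + 1)%:R = K.+1%:R - n%:R :> R.
  by rewrite -natrB; [congr _%:R; rewrite /k|]; lia.
rewrite {}knE in B *.
have {S1} EA1 : A1 = (sigma_poly t K)`_n.+2 - (1 - t) ^+ n.+1 - 'C(K.+1, n.+1)%:R * t ^+ n.+1.
  by rewrite S1; ring.
have {S2} EA2 : A2 = t * (sigma_poly t K)`_n.+1 - 'C(K.+1, n)%:R * t ^+ n.+1.
  by rewrite S2; ring.
rewrite {}EA1 {}EA2; have -> : k%:R = K%:R + 2 :> R by rewrite -natrD addn2.
move: (sigma_poly t K)`_n.+2 (sigma_poly t K)`_n.+1 S3 => s2 s1 S3.
move: ((1 - t) ^+ n.+1) (t ^+ n.+1) 'C(K.+1, n)%:R 'C(K.+1, n.+1)%:R B S3 => U T C0 C' B S3.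
apply/eqP; rewrite -subr_eq0; apply/eqP.
transitivity ((n%:R - K%:R) * (s2 - ((1 - t) * s1 + C' * T))
  - T * ((K.+1%:R - n%:R) * C0 - n.+1%:R * C')); first by ring.
by rewrite S3 B; ring.
Qed.
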